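(* Let $\mathfrak k$ be a splittable subalgebra of a locally reductive Lie algebra $\mathfrak g$, and let $\mathfrak h$ be a subalgebra of $\mathfrak k$. The following are equivalent: (1) $\mathfrak h=\mathfrak z_{\mathfrak k}(\mathfrak h_{ss})$; (2) $\mathfrak h=\mathfrak z_{\mathfrak k}(\mathfrak t)$ for some maximal toral subalgebra $\mathfrak t$ of $\mathfrak k$; (3) $\mathfrak h=\overline{\mathfrak k^0(\mathfrak h)}$. Moreover, any subalgebra $\mathfrak h$ satisfying these conditions is locally nilpotent, splittable, and self-normalizing in $\mathfrak k$.
   Context: Ground field $\mathbb C$, countable dimensions. A Lie algebra $\mathfrak g$ is locally reductive if it is a union of nested finite-dimensional reductive Lie algebras $\mathfrak g_n\subset\mathfrak g_{n+1}$ with $\mathfrak g_n$ reductive in $\mathfrak g_{n+1}$. Then every $X\in\mathfrak g$ has a Jordan decomposition $X=X_{ss}+X_{nil}$ with $X_{ss},X_{nil}\in\mathfrak g$ (for $X\in\mathfrak g_n$ they are the semisimple and nilpotent parts of $\mathrm{ad}X$ on $\mathfrak g_n$, independent of $n$); $X$ is semisimple if $X=X_{ss}$. A subalgebra $\mathfrak k$ is splittable if $X_{ss},X_{nil}\in\mathfrak k$ for all $X\in\mathfrak k$. For a subalgebra $\mathfrak h$, $\mathfrak h_{ss}:=\{X_{ss}:X\in\mathfrak h\}$. For a subset $\mathfrak a\subset\mathfrak g$, $\mathfrak z_{\mathfrak k}(\mathfrak a)$ is the set of elements of $\mathfrak k$ commuting with all elements of $\mathfrak a$. A toral subalgebra is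 a subalgebra consisting of semisimple elements; maximal toral means maximal among toral subalgebras of $\mathfrak k$. $\overline{\mathfrak k^0(\mathfrak h)}$ is the set of $x\in\mathfrak k$ on which every finite-dimensional subalgebra $\mathfrak h_{fin}\subset\mathfrak h$ acts locally nilpotently (i.e. there is $n$ with $\mathrm{ad}y_1\cdots\mathrm{ad}y_n(x)=0$ for all $y_1,\dots,y_n\in\mathfrak h_{fin}$). Locally nilpotent: every finite subset lies in a finite-dimensional nilpotent subalgebra. Self-normalizing in $\mathfrak k$: equal to its normalizer in $\mathfrak k$. *)

(* Defs.v *)
From HB Require Import structures.
From mathcomp Require Import all_boot all_order all_algebra.
Set Implicit Arguments. Unset Strict Implicit. Unset Printing Implicit Defensive.
Import Order.TTheory GRing.Theory Num.Theory.
Local Open Scope ring_scope.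

Section LieDefs.
Variables (F : fieldType) (V : lmodType F) (br : V -> V -> V).

Definition is_lie_bracket : Prop :=
  (forall (a : F) (x y z : V), br (a *: x + y) z = a *: br x z + br y z) /\
  (forall (a : F) (x y z : V), br z (a *: x + y) = a *: br z x + br z y) /\
  (forall x : V, br x x = 0) /\
  (forall x y z : V, br x (br y z) + br y (br z x) + br z (br x y) = 0).

Definition pset_eq (A B : V -> Prop) : Prop := forall x, A x <-> B x.
Definition psubset (A B : V -> Prop) : Prop := forall x, A x -> B x.

Definition subspace (A : V -> Prop) : Prop :=
  A 0 /\ forall (a : F) x y, A x -> A y -> A (a *: x + y).
Definition subalgebra (A : V -> Prop) : Prop :=
  subspace A /\ forall x y, A x -> A y -> A (br x y).
Definition fin_dim (A : V -> Prop) : Prop :=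
  exists (n : nat) (b : 'I_n -> V),
    forall x, A x <-> exists c : 'I_n -> F, x = \sum_(i < n) c i *: b i.

Definition ad_invariant (A W : V -> Prop) : Prop :=
  forall x y, A x -> W y -> W (br x y).

Definition reductive_in (A B : V -> Prop) : Prop :=
  forall W, subspace W -> psubset W B -> ad_invariant A W ->
  exists W', [/\ subspace W', psubset W' B, ad_invariant A W',
     (forall x, W x -> W' x -> x = 0) &
     (forall x, B x -> exists y z, [/\ W y, W' z & x = y + z])].

Definition locally_reductive (gs : nat -> V -> Prop) : Prop :=
  (forall n, [/\ subalgebra (gs n), fin_dim (gs n), reductive_in (gs n) (gs n),
              psubset (gs n) (gs n.+1) & reductive_in (gs n) (gs n.+1)]) /\
  (forall x, exists n, gs n x).

Definition in_derived (A : V -> Prop) (m : V) : Prop :=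
  exists l : seq (V * V), (forall p, p \in l -> A p.1 /\ A p.2) /\
                          m = \sum_(p <- l) br p.1 p.2.

(* ad s restricted to A is semisimple (= diagonalizable, F alg. closed) *)
Definition ad_diag_on (A : V -> Prop) (s : V) : Prop :=
  forall y, A y -> exists l : seq (F * V),
    (forall p, p \in l -> A p.2 /\ br s p.2 = p.1 *: p.2) /\
    y = \sum_(p <- l) p.2.

Definition ad_nilp_on (A : V -> Prop) (m : V) : Prop :=
  exists k : nat, forall y, A y -> iter k (br m) y = 0.

(* Jordan decomposition X = s + m inside the finite-dimensional reductive
   algebra A: ad s = (ad X)_ss and ad m = (ad X)_nil on A, with the
   nilpotent part in [A,A] (which fixes the ambiguity coming from the center). *)
Definition jordan_in (A : V -> Prop) (X s m : V) : Prop :=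
  [/\ A s, A m, X = s + m, br s m = 0 &
      [/\ ad_diag_on A s, ad_nilp_on A m & in_derived A m]].

Definition jordanD (gs : nat -> V -> Prop) (X s m : V) : Prop :=
  exists n, gs n X /\ jordan_in (gs n) X s m.

Definition semisimple_elt (gs : nat -> V -> Prop) (X : V) : Prop :=
  jordanD gs X X 0.

Definition splittable (gs : nat -> V -> Prop) (K : V -> Prop) : Prop :=
  forall X s m, K X -> jordanD gs X s m -> K s /\ K m.

Definition ss_part (gs : nat -> V -> Prop) (H : V -> Prop) : V -> Prop :=
  fun s => exists X m, H X /\ jordanD gs X s m.

Definition centralizer (K A : V -> Prop) : V -> Prop :=
  fun x => K x /\ forall y, A y -> br x y = 0.

Definition toral (gs : nat -> V -> Prop) (T : V -> Prop) : Prop :=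
  subalgebra T /\ forall x, T x -> semisimple_elt gs x.

Definition max_toral (gs : nat -> V -> Prop) (K T : V -> Prop) : Prop :=
  [/\ toral gs T, psubset T K &
      forall T', toral gs T' -> psubset T' K -> psubset T T' -> psubset T' T].

Definition acts_nilp_on (A : V -> Prop) (x : V) : Prop :=
  exists n : nat, forall ys : seq V, size ys = n ->
    (forall y, y \in ys -> A y) -> foldr br x ys = 0.

Definition k0bar (K H : V -> Prop) : V -> Prop :=
  fun x => K x /\ forall Hf, subalgebra Hf -> fin_dim Hf -> psubset Hf H ->
                             acts_nilp_on Hf x.

Definition nilpotent_alg (A : V -> Prop) : Prop :=
  exists n : nat, forall (ys : seq V) (x : V), size ys = n ->
    (forall y, y \in ys -> A y) -> A x -> foldr br x ys = 0.

Definition loc_nilpotent (H : V -> Prop) : Prop :=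
  forall l : seq V, (forall x, x \in l -> H x) ->
    exists A, [/\ subalgebra A, fin_dim A, nilpotent_alg A, psubset A H &
                  forall x, x \in l -> A x].

Definition normalizer (K H : V -> Prop) : V -> Prop :=
  fun x => K x /\ forall y, H y -> H (br x y).

Definition self_normalizing (K H : V -> Prop) : Prop :=
  pset_eq H (normalizer K H).

End LieDefs.

(* Main.v *)
(** Write [X = X_ss + X_nil]. The decomposition exists in each [gs n] by Cartan's
    criterion: the Killing form is nondegenerate on [[gs n, gs n]], so that the
    derivation [(ad X)_nil] is inner. It persists in [gs n.+1]: the
    [ad s]-eigenvectors of [gs n.+1] span a [gs n]-submodule whose complement
    contains no eigenvector, hence is zero; and the generalized eigenspaces of
    [ad m] are [gs n]-modules, on which the sum of commutators [m] has trace zero,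
    so that [0] is its only eigenvalue.

    If [ad X] acts nilpotently on [u], then [X_ss] commutes with [u]; thus an element
    commuting with [X] commutes with [X_ss], and toral subalgebras are abelian.
    Under (1), [H_ss] is central in [H] and is a maximal toral subalgebra of [K];
    under (2), adjoining to [T] the semisimple part of an element of [H] gives a
    toral subalgebra, so that [H_ss = T]. Elements of [H] act on the centralizer of
    [H_ss] through their nilpotent parts, and Engel's theorem turns this into local
    nilpotency of [H] and into (3). Conversely (3) makes [ad X], for [X] in [H],
    nilpotent on every element of [H], so that [H_ss] is central in [H]. *)
Require Import Defs.
From HB Require Import structures.
From mathcomp Require Import all_boot all_order all_algebra.
From mathcomp Require Import boolp zify.
Set Implicit Arguments. Unset Strict Implicit. Unset Printing Implicit Defensive.
Import GRing.Theory.
Local Open Scope ring_scope.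

(** * Generalized eigenspaces and traces *)

Section Subspace.
Variables (F : fieldType) (V : lmodType F) (W : V -> Prop).

Lemma subspaceD x y :
  subspace W -> W x -> W y -> W (x + y).
Proof. by move=> [_ HW] Wx Wy; rewrite -[x]scale1r; apply: HW. Qed.

Lemma subspaceZ a x :
  subspace W -> W x -> W (a *: x).
Proof. by move=> [W0 HW] Wx; rewrite -[_ *: x]addr0; apply: HW. Qed.

Lemma subspaceN x :
  subspace W -> W x -> W (- x).
Proof. by move=> HW Wx; rewrite -scaleN1r; apply: subspaceZ. Qed.

Lemma subspaceB x y :
  subspace W -> W x -> W y -> W (x - y).
Proof. by move=> HW Wx Wy; apply: subspaceD => //; apply: subspaceN. Qed.

Lemma subspace_sum (I : Type) (r : seq I)
    (P : pred I) (f : I -> V) :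
  subspace W -> (forall i, P i -> W (f i)) -> W (\sum_(i <- r | P i) f i).
Proof.
move=> HW Wf; elim/big_ind: _ => //; first by case: HW.
by move=> x y; apply: subspaceD.
Qed.

End Subspace.

Section Spectral.
Variable F : closedFieldType.

Lemma prod_XsubC_exp_dvdp (rs : seq F) (k : F -> nat) (p : {poly F}) :
  uniq rs -> (forall c, c \in rs -> ('X - c%:P) ^+ k c %| p) ->
  \prod_(c <- rs) ('X - c%:P) ^+ k c %| p.
Proof.
elim: rs => [|c rs IH] /=; first by rewrite big_nil dvd1p.
case/andP=> cNrs Urs Hp; rewrite big_cons Gauss_dvdp.
  rewrite Hp ?mem_head //= IH // => c' c'rs; apply: Hp.
  by rewrite in_cons c'rs orbT.
apply: coprimep_expl; rewrite big_seq.
elim/big_ind: _ => [|p1 p2|c' c'rs]; first exact: coprimep1.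
  by rewrite coprimepMr => -> ->.
apply: coprimep_expr; rewrite coprimep_XsubC root_XsubC.
by apply: contraNneq cNrs => <-.
Qed.

(** Chinese remaindering by induction on [rs]: the Bezout term [v * Q] is 1 modulo the new factor
    and 0 modulo the old ones, so a multiple of it corrects [q] at [c] alone. *)
Lemma crt_poly (rs : seq F) (e : nat) (phi : F -> F) : uniq rs ->
  exists q : {poly F}, forall c, c \in rs -> ('X - c%:P) ^+ e %| q - (phi c)%:P.
Proof.
elim: rs => [|c rs IH] /=; first by exists 0.
case/andP=> cNrs Urs; have [q Hq] := IH Urs.
pose Q := \prod_(c <- rs) ('X - c%:P) ^+ e.
have QP c' : c' \in rs -> ('X - c'%:P) ^+ e %| Q.
  by move=> c'rs; rewrite /Q (big_rem _ c'rs) /=; exact: dvdp_mulr.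
have : coprimep (('X - c%:P) ^+ e) Q.
  apply: coprimep_expl; rewrite /Q big_seq.
  elim/big_ind: _ => [|p1 p2|c' c'rs]; first exact: coprimep1.
    by rewrite coprimepMr => -> ->.
  apply: coprimep_expr; rewrite coprimep_XsubC root_XsubC.
  by apply: contraNneq cNrs => <-.
move=> /Bezout_eq1_coprimepP[[u v] /= uv1].
exists (q + ((phi c)%:P - q) * (v * Q)) => c'; rewrite in_cons => /orP[/eqP->|c'rs].
  have -> : v * Q = 1 - u * ('X - c%:P) ^+ e by rewrite -uv1 addrC addKr.
  rewrite mulrBr mulr1 addrA [q + _]addrC subrK addrAC subrr add0r dvdpNr.
  by rewrite mulrA dvdp_mull.
by rewrite addrAC dvdp_add ?Hq // mulrA dvdp_mull ?QP.
Qed.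

(* The [P c] are the projections onto the generalized eigenspaces of [M].
   The list [rs] is allowed to contain values that are not eigenvalues (then
   [P c = 0]), so that it can be made to contain sums of eigenvalues. *)
Definition spectral_family n (M : 'M[F]_n) (e : nat) (rs : seq F)
    (P : F -> 'M[F]_n) : Prop :=
  [/\ uniq rs, \sum_(c <- rs) P c = 1%:M,
      (forall c, P c *m (M - c%:M) ^+ n = 0),
      (forall c k m (w : 'M_(m, n)), c \in rs -> (k <= e)%N ->
        w *m (M - c%:M) ^+ k = 0 -> w *m P c = w) &
      [/\ (forall c c', P c *m P c' = if c == c' then P c else 0),
          (forall c (B : 'M_n), B *m M = M *m B -> B *m P c = P c *m B) &
          (forall c W, subspace W -> (forall w : 'rV_n, W w -> W (w *m M)) ->
             forall w, W w -> W (w *m P c))]].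

(** [P c] is a polynomial in [M], congruent to 1 modulo a power of ['X - c%:P] and to 0 modulo the
    same power at the other entries. Matrix identities become divisibilities settled by
    Cayley-Hamilton. [L] lets a caller add values computed from the eigenvalues [zs]. *)
Lemma spectral_family_exists_pos n (M : 'M[F]_n.+1) (e : nat) (L : seq F -> seq F) :
  exists zs rs P, [/\ {subset zs <= rs}, {subset L zs <= rs},
    (forall c, c \in rs -> c \notin zs -> P c = 0) & spectral_family M e rs P].
Proof.
have [zs Ezs] := closed_field_poly_normal (char_poly M).
rewrite (monicP (char_poly_monic M)) scale1r in Ezs.
pose rs := undup (zs ++ L zs).
have Urs : uniq rs by apply: undup_uniq.
(* The summand [n.+1] serves Cayley-Hamilton, [e] the clause on vectors killed by a power
   [k <= e]. *)
pose E := (e + n.+1)%N.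
(* Roots of the characteristic polynomial have multiplicity at most [n.+1], so it divides [p]. *)
have kill p : (forall c, c \in zs -> ('X - c%:P) ^+ n.+1 %| p) -> horner_mx M p = 0.
  move=> Hp; have : char_poly M %| p.
    rewrite Ezs -prodr_undup_exp_count.
    apply: prod_XsubC_exp_dvdp (undup_uniq _) _ => c.
    rewrite mem_undup => czs; apply: dvdp_trans (Hp _ czs).
    apply: dvdp_exp2l; apply: leq_trans (count_size _ _) _.
    have : size (char_poly M) = (size zs).+1 by rewrite Ezs size_prod_XsubC.
    by rewrite size_char_poly => -[<-].
  by case/dvdpP => r ->; rewrite rmorphM /= Cayley_Hamilton mulr0.
have sub1 : {subset zs <= rs} by move=> c cz; rewrite mem_undup mem_cat cz.
have /choice [q Hq] : forall c, exists q : {poly F}, forall c', c' \in rs ->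
    ('X - c'%:P) ^+ E %| q - ((c' == c)%:R)%:P.
  by move=> c; apply: (crt_poly E (fun c' => (c' == c)%:R)).
exists zs, rs, (fun c => horner_mx M (q c)).
have ltE (c : F) : ('X - c%:P) ^+ n.+1 %| ('X - c%:P) ^+ E.
  by apply: dvdp_exp2l; apply: leq_addl.
have dq c c' : c' \in rs -> c' != c -> ('X - c'%:P) ^+ n.+1 %| q c.
  move=> c'rs /negPf Hc; apply: (dvdp_trans (ltE c')).
  by have := Hq c _ c'rs; rewrite Hc subr0.
split => //.
- by move=> c cL; rewrite mem_undup mem_cat cL orbT.
- move=> c _ cNzs; apply: kill => c' c'zs.
  by apply: dq; [exact: sub1|apply: contraNneq cNzs => <-].
have Xc c : horner_mx M ('X - c%:P) = M - c%:M.
  by rewrite rmorphB /= horner_mx_X horner_mx_C.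
split => //.
- rewrite -rmorph_sum /=; apply/eqP; rewrite -subr_eq0.
  have -> : 1%:M = horner_mx M 1%:P by rewrite horner_mx_C.
  rewrite -rmorphB /=; apply/eqP/kill => c czs.
  have crs := sub1 _ czs.
  rewrite (bigD1_seq c) //= -addrAC; apply: dvdp_add.
    by apply: dvdp_trans (ltE c) _; have := Hq c _ crs; rewrite eqxx.
  apply: (big_ind (fun p => ('X - c%:P) ^+ n.+1 %| p)) => //.
  - exact: dvdp_add.
  - by move=> i ic; apply: dq => //; rewrite eq_sym.
- move=> c; rewrite -[M - _]Xc -rmorphXn mulmxE -rmorphM /=; apply: kill => c' c'zs.
  have [->|ne] := eqVneq c' c.
    by apply: dvdp_mull.
  by apply: dvdp_mulr; apply: dq => //; apply: sub1.
- move=> c k m w crs ke wk.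
  have := Hq c _ crs; rewrite eqxx => /dvdpP[r Hr].
  apply/eqP; rewrite -subr_eq0 -[X in _ - X]mulmx1 -mulmxBr.
  have -> : horner_mx M (q c) - 1%:M = horner_mx M (q c - 1%:P).
    by rewrite rmorphB /= horner_mx_C.
  rewrite Hr mulrC rmorphM /= rmorphXn /= Xc -mulmxE mulmxA.
  have -> : E = (k + (E - k))%N by rewrite subnKC // /E (leq_trans ke) ?leq_addr.
  by rewrite exprD -mulmxE (mulmxA w) wk !mul0mx.
split.
- move=> c c'; rewrite mulmxE -rmorphM /=; apply/eqP; case: ifP => [/eqP <-|ne].
    rewrite -subr_eq0 -rmorphB /=; apply/eqP/kill => z /sub1 zrs.
    rewrite -{3}[q c]mulr1 -mulrBr.
    have [Ez|ne] := eqVneq z c; last by rewrite dvdp_mulr ?dq.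
    apply/dvdp_mull/(dvdp_trans (ltE _)).
    by have := Hq c _ zrs; rewrite Ez eqxx.
  apply/eqP; apply: kill => z /sub1 zrs.
  have [Ez|ne'] := eqVneq z c; last by rewrite dvdp_mulr ?dq.
  by rewrite dvdp_mull ?dq // Ez ne.
- by move=> c B HB; apply/comm_mx_horner.
- move=> c W HW WM w Ww.
  elim/poly_ind: (q c) => [|p a IH]; first by rewrite rmorph0 mulmx0; case: HW.
  rewrite rmorphD rmorphM /= horner_mx_X horner_mx_C mulmxDr -mulmxE mulmxA.
  rewrite mul_mx_scalar; apply: subspaceD => //; last exact: subspaceZ.
  exact: WM.
Qed.

Lemma spectral_family_exists n (M : 'M[F]_n) (e : nat) (L : seq F -> seq F) :
  exists zs rs P, [/\ {subset zs <= rs}, {subset L zs <= rs},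
    (forall c, c \in rs -> c \notin zs -> P c = 0) & spectral_family M e rs P].
Proof.
case: n => [|n] in M *; last exact: spectral_family_exists_pos.
exists [::], (undup (L [::])), (fun=> 0); split => //.
  by move=> c; rewrite mem_undup.
split; first exact: undup_uniq.
- by rewrite [LHS]flatmx0 [RHS]flatmx0.
- by move=> c; rewrite mul0mx.
- by move=> c k m w _ _ _; rewrite [RHS]thinmx0 [LHS]thinmx0.
split=> [c c'|c B _|c W [W0 _] _ w _]; first by rewrite mulmx0; case: ifP.
  by rewrite mulmx0 mul0mx.
by rewrite mulmx0.
Qed.

(** In the full-rank factorization [P = C R], idempotence forces [R C = 1], and [C R] has the same
    trace as [R C], an identity matrix of size [\rank P]. *)
Lemma mxtrace_idem n (P : 'M[F]_n) : P *m P = P -> \tr P = (\rank P)%:R.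
Proof.
move=> PP; rewrite -{1}[P]mulmx_base mxtrace_mulC.
suff -> : row_base P *m col_base P = 1%:M by rewrite mxtrace1.
apply: (row_full_inj (col_base_full P)); apply: (row_free_inj (row_base_free P)).
by rewrite /= mulmx1 mulmxA -mulmxA !mulmx_base PP.
Qed.

(** Strong induction on the size: with [M = C R] of full rank, [R C] has the same trace, is again
    nilpotent, and is smaller because a nilpotent matrix is singular. *)
Lemma mxtrace_nilpotent n (M : 'M[F]_n) k : M ^+ k = 0 -> \tr M = 0.
Proof.
elim/ltn_ind: n => n IH in M k *.
case: (posnP n) => [n0|n_gt0] Mk.
  by subst n; rewrite /mxtrace big_ord0.
have rkM : (\rank M < n)%N.
  rewrite ltn_neqAle rank_leq_row andbT; apply/negP => Mfree.
  elim: k Mk => [|k IHk] Mk.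
    move: (congr1 (fun A : 'M[F]_n => A (Ordinal n_gt0) (Ordinal n_gt0)) Mk).
    by rewrite !mxE eqxx => /eqP; rewrite oner_eq0.
  apply/IHk/(row_free_inj Mfree); rewrite mul0mx.
  by move: Mk; rewrite exprSr.
rewrite -[M]mulmx_base mxtrace_mulC; apply: IH rkM _ k.+1 _.
move: (row_base M) (col_base M) (mulmx_base M) => R C CR.
have aux j : (R *m C) ^+ j.+1 = R *m M ^+ j *m C.
  elim: j => [|j IHj]; first by rewrite expr1 expr0 mulmx1.
  rewrite exprSr IHj exprSr -!mulmxE -!mulmxA; congr (_ *m (_ *m _)).
  by rewrite mulmxA CR.
by rewrite aux Mk mulmx0 mul0mx.
Qed.

End Spectral.

(** * Lie brackets and subspaces *)

Section LieBasics.
Variables (F : fieldType) (V : lmodType F) (br : V -> V -> V).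
Hypothesis Lbr : is_lie_bracket br.

Lemma brDl x y z : br (x + y) z = br x z + br y z.
Proof. by have [H _] := Lbr; rewrite -[x]scale1r H !scale1r. Qed.

Lemma brDr x y z : br z (x + y) = br z x + br z y.
Proof. by have [_ [H _]] := Lbr; rewrite -[x]scale1r H !scale1r. Qed.

Lemma br0l z : br 0 z = 0.
Proof. by apply: (addIr (br 0 z)); rewrite -brDl !add0r. Qed.

Lemma br0r z : br z 0 = 0.
Proof. by apply: (addIr (br z 0)); rewrite -brDr !add0r. Qed.

Lemma brZl a x z : br (a *: x) z = a *: br x z.
Proof. by have [H _] := Lbr; rewrite -[a *: x]addr0 H br0l addr0. Qed.

Lemma brZr a x z : br z (a *: x) = a *: br z x.
Proof. by have [_ [H _]] := Lbr; rewrite -[a *: x]addr0 H br0r addr0. Qed.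

Lemma brNl x z : br (- x) z = - br x z.
Proof. by rewrite -scaleN1r brZl scaleN1r. Qed.

Lemma brNr x z : br z (- x) = - br z x.
Proof. by rewrite -scaleN1r brZr scaleN1r. Qed.

Lemma brBl x y z : br (x - y) z = br x z - br y z.
Proof. by rewrite brDl brNl. Qed.

Lemma brBr x y z : br z (x - y) = br z x - br z y.
Proof. by rewrite brDr brNr. Qed.

Lemma br_suml (I : Type) (r : seq I) (P : pred I) (f : I -> V) z :
  br (\sum_(i <- r | P i) f i) z = \sum_(i <- r | P i) br (f i) z.
Proof. by elim/big_rec2: _ => [|i x y _ <-]; rewrite ?br0l // brDl. Qed.

Lemma br_sumr (I : Type) (r : seq I) (P : pred I) (f : I -> V) z :
  br z (\sum_(i <- r | P i) f i) = \sum_(i <- r | P i) br z (f i).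
Proof. by elim/big_rec2: _ => [|i x y _ <-]; rewrite ?br0r // brDr. Qed.

Lemma brxx x : br x x = 0.
Proof. by have [_ [_ [-> _]]] := Lbr. Qed.

Lemma brC x y : br x y = - br y x.
Proof.
have := brxx (x + y); rewrite brDl !brDr !brxx add0r addr0 => /eqP.
by rewrite addr_eq0 => /eqP.
Qed.

Lemma br_jacobi x y z : br x (br y z) = br (br x y) z + br y (br x z).
Proof.
have [_ [_ [_ /(_ x y z)]]] := Lbr.
rewrite (brC z (br x y)) (brC z x) brNr => /eqP.
by rewrite subr_eq0 subr_eq addrC => /eqP ->; rewrite addrC.
Qed.

Lemma subspace_centralizer (K A : V -> Prop) :
  subspace K -> subspace (centralizer br K A).
Proof.
move=> HK; split; first by split=> [|y _]; [case: HK|exact: br0l].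
move=> a x y [Kx Hx] [Ky Hy]; split; first by case: HK => _; apply.
by move=> z Az; rewrite brDl brZl Hx // Hy // scaler0 addr0.
Qed.

Lemma subalgebra_centralizer (K A : V -> Prop) :
  subalgebra br K -> subalgebra br (centralizer br K A).
Proof.
move=> [HK KK]; split; first exact: subspace_centralizer.
move=> x y [Kx Hx] [Ky Hy]; split; first exact: KK.
move=> z Az; have := br_jacobi x y z.
by rewrite (Hx z) // (Hy z) // !br0r addr0 => <-.
Qed.

Lemma in_derived_subspace (A : V -> Prop) :
  subspace A -> subspace (in_derived br A).
Proof.
move=> HA; split; first by exists [::]; rewrite big_nil.
move=> a x y [lx [Ax ->]] [ly [Ay ->]].
exists ([seq (a *: p.1, p.2) | p <- lx] ++ ly); split.
  move=> p; rewrite mem_cat => /orP[/mapP[q /Ax[q1 q2] ->]|/Ay//].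
  by split=> //; exact: subspaceZ HA q1.
by rewrite big_cat big_map scaler_sumr; congr (_ + _); apply: eq_bigr => p _;
  rewrite brZl.
Qed.

Lemma in_derived_br (A : V -> Prop) x y : A x -> A y -> in_derived br A (br x y).
Proof.
move=> Ax Ay; exists [:: (x, y)]; split; last by rewrite big_seq1.
by move=> p; rewrite inE => /eqP ->.
Qed.

Lemma in_derived_sub (A W : V -> Prop) m : subspace W ->
  (forall x y, A x -> A y -> W (br x y)) -> in_derived br A m -> W m.
Proof.
move=> HW AW [l [Hl ->]]; rewrite big_seq; apply: subspace_sum => // p /Hl[].
exact: AW.
Qed.

Lemma in_derivedS (A B : V -> Prop) m :
  psubset A B -> in_derived br A m -> in_derived br B m.
Proof. by move=> AB [l [Hl ->]]; exists l; split=> // p /Hl[/AB ? /AB]. Qed.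

Lemma foldr_br_sum (ys : seq V) (I : Type) (r : seq I) (f : I -> V) :
  foldr br (\sum_(i <- r) f i) ys = \sum_(i <- r) foldr br (f i) ys.
Proof. by elim: ys => [|y ys IH] //=; rewrite IH br_sumr. Qed.

Lemma foldr_iter (ys : seq V) y w :
  (forall z, z \in ys -> z = y) -> foldr br w ys = iter (size ys) (br y) w.
Proof.
elim: ys => [|z ys IH] //= Hy; rewrite IH => [|z' z'ys]; last first.
  by apply: Hy; rewrite in_cons z'ys orbT.
by rewrite (Hy z) ?mem_head.
Qed.

End LieBasics.

(** * Subspaces of row vectors as row spaces of matrices *)

Section RowSpaces.
Variables (F : fieldType) (d : nat).
Implicit Types A W : 'rV[F]_d -> Prop.

(** Vectors of [A] outside the current row space are added one at a time; [r] bounds the remaining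
    codimension. *)
Lemma subspace_rowspace A : subspace A ->
  exists M : 'M[F]_d, forall x, A x <-> (x <= M)%MS.
Proof.
move=> HA.
suff H r : forall M : 'M[F]_d, (d - \rank M <= r)%N ->
    (forall x : 'rV_d, (x <= M)%MS -> A x) ->
    exists M : 'M[F]_d, forall x, A x <-> (x <= M)%MS.
  apply: (H d 0) => [|x]; first exact: leq_subr.
  by rewrite submx0 => /eqP ->; case: HA.
elim: r => [|r IH] M rM MA.
  exists M => x; split; last exact: MA.
  by move=> _; rewrite submx_full // /row_full eqn_leq rank_leq_col -subn_eq0 -leqn0.
have [[x [Ax xM]]|nx] := pselect (exists x, A x /\ ~~ (x <= M)%MS); last first.
  exists M => x; split; last exact: MA.
  by move=> Ax; apply/negPn/negP => xM; apply: nx; exists x.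
apply: (IH (M + x)%MS) => [|y /sub_addsmxP[[u v] /= ->]].
  have : (\rank M < \rank (M + x)%MS)%N.
    rewrite (ltn_leqif (mxrank_leqif_sup (addsmxSl _ _))).
    by apply: contra xM; apply: submx_trans; apply: addsmxSr.
  by move: rM => {IH}; lia.
apply: subspaceD => //; first by apply: MA; apply: submxMl.
by rewrite [v]mx11_scalar mul_scalar_mx; apply: subspaceZ.
Qed.

End RowSpaces.

(** * Engel's theorem *)

Section Engel.
Variables (F : fieldType) (d : nat) (br : 'rV[F]_d -> 'rV[F]_d -> 'rV[F]_d).
Hypothesis Lbr : is_lie_bracket br.
Implicit Types A W : 'rV[F]_d -> Prop.

Definition ad_loc_nilp A W :=
  forall a w, A a -> W w -> exists k, iter k (br a) w = 0.

Lemma rowspace_subspace (M : 'M[F]_d) : subspace (fun x : 'rV_d => (x <= M)%MS).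
Proof.
split; first exact: sub0mx.
by move=> a x y Hx Hy; apply: addmx_sub => //; apply: scalemx_sub.
Qed.

Lemma rowspace_ltn (M N : 'M[F]_d) (w : 'rV_d) :
  (forall x : 'rV_d, (x <= M)%MS -> (x <= N)%MS) -> (w <= N)%MS -> ~~ (w <= M)%MS ->
  (\rank M < \rank N)%N.
Proof.
move=> MN wN wM; have sMN : (M <= N)%MS.
  by apply/row_subP => i; apply: MN; apply: row_sub.
rewrite (ltn_leqif (mxrank_leqif_sup sMN)).
by apply: contra wM; apply: submx_trans.
Qed.

(* Engel's theorem, phrased for a subspace [W1] of [W] instead of the quotient
   [W / W1]. *)
Lemma engel_vector A W W1 :
  subalgebra br A -> subspace W -> ad_invariant br A W ->
  subspace W1 -> ad_invariant br A W1 ->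
  ad_loc_nilp A A -> ad_loc_nilp A W -> (exists w, W w /\ ~ W1 w) ->
  exists w, [/\ W w, ~ W1 w & forall a, A a -> W1 (br a w)].
Proof.
move=> SA; have [MA] := subspace_rowspace SA.1.
have [r] := ubnP (\rank MA).
elim: r A SA W W1 MA => [//|r IH] A SA W W1 MA rA HMA HW AW HW1 AW1 nA nW [w [Ww W1w]].
have [sA AA] := SA.
(* Proper subalgebras of [A], given by matrices so that a maximal one can be chosen by rank. *)
pose good (B : 'M[F]_d) := [/\ forall x : 'rV_d, (x <= B)%MS -> A x,
  subalgebra br (fun x : 'rV_d => (x <= B)%MS) & ~~ (MA <= B)%MS].
have [A0|nzA] := eqVneq (\rank MA) 0%N.
  exists w; split=> // a /HMA.
  move/eqP: A0; rewrite mxrank_eq0 => /eqP ->; rewrite submx0 => /eqP ->.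
  by rewrite (br0l Lbr); case: HW1.
have goodP : exists n, `[< exists2 B, good B & \rank B = n >].
  exists 0%N; apply/asboolP; exists 0; last by rewrite mxrank0.
  split=> [x|| ]; first by rewrite submx0 => /eqP ->; case: sA.
    split; first exact: rowspace_subspace.
    by move=> x y; rewrite !submx0 => /eqP -> _; rewrite (br0l Lbr).
  by rewrite submx0 -mxrank_eq0.
have goodb n : `[< exists2 B, good B & \rank B = n >] -> (n <= d)%N.
  by move/asboolP => [B _ <-]; apply: rank_leq_col.
case: (ex_maxnP goodP goodb) => _ /asboolP[B [BA [sB BB] ABn] <-] Bmax.
pose PB := fun x : 'rV_d => (x <= B)%MS.
have rB : (\rank B < r)%N.
  have [x xA xB] : exists2 x : 'rV_d, (x <= MA)%MS & ~~ (x <= B)%MS.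
    by have /row_subPn[i Hi] := ABn; exists (row i MA) => //; apply: row_sub.
  rewrite (leq_trans (rowspace_ltn _ xA xB)) // => y yB.
  by apply/HMA; apply: BA.
(* Induction for [B] acting on [A] modulo [B] gives an element outside [B] that normalizes [B]. *)
have [a [Aa aB Ba]] : exists a, [/\ A a, ~ PB a & forall b, PB b -> PB (br b a)].
  apply: (IH PB _ A PB B) => //.
  - by move=> x y /BA; apply: AA.
  - by move=> x y /BA Ax /BA; apply: nA.
  - by move=> x y /BA; apply: nA.
  - have /row_subPn[i Hi] := ABn; exists (row i MA); split; last exact/negP.
    by apply/HMA; apply: row_sub.
(* [B] and [a] span a subalgebra larger than [B], hence all of [A] by maximality. *)
have AE x : A x -> exists b c, PB b /\ x = b + c *: a.
  pose C := (B + a)%MS.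
  have CP y : (y <= C)%MS <-> exists b c, PB b /\ y = b + c *: a.
    split.
      move/sub_addsmxP => [[u v] /= ->]; exists (u *m B), (v 0 0); split.
        exact: submxMl.
      by rewrite [v in LHS]mx11_scalar mul_scalar_mx.
    move=> [b [c [Bb ->]]]; apply: addmx_sub.
      exact: submx_trans Bb (addsmxSl _ _).
    by apply: scalemx_sub; apply: addsmxSr.
  have : ~ good C.
    move=> gC; have /Bmax : `[< exists2 B', good B' & \rank B' = \rank C >].
      by apply/asboolP; exists C.
    rewrite leqNgt => /negP; apply.
    apply: (@rowspace_ltn _ _ a) => [y yB||]; last exact/negP.
      exact: submx_trans yB (addsmxSl _ _).
    exact: addsmxSr.
  move=> ngC Ax; apply/CP; apply: submx_trans (_ : MA <= C)%MS; first exact/HMA.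
  apply: contrapT => MAC; apply: ngC; split; last exact/negP.
    by move=> y /CP[b [c [Bb ->]]]; apply: (subspaceD sA (BA _ Bb)); apply: subspaceZ.
  split; first exact: rowspace_subspace.
  move=> y z /CP[b [c [Bb ->]]] /CP[b' [c' [Bb' ->]]]; apply/CP.
  exists (br b b' + c' *: br b a - c *: br b' a), 0; split; last first.
    rewrite scale0r addr0 (brDl Lbr) !(brDr Lbr) !(brZl Lbr) !(brZr Lbr).
    by rewrite (brxx Lbr) !scaler0 addr0 (brC Lbr a b') scalerN.
  apply: (subspaceB (rowspace_subspace B)).
    apply: (subspaceD (rowspace_subspace B)); first exact: BB.
    by apply: scalemx_sub; apply: Ba.
  by apply: scalemx_sub; apply: Ba.
(* Induction again, now for [B] acting on [W] modulo [W1]. *)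
have [u [Wu W1u Bu]] : exists w, [/\ W w, ~ W1 w & forall b, PB b -> W1 (br b w)].
  apply: (IH PB _ W W1 B) => //.
  - by move=> x y /BA; apply: AW.
  - by move=> x y /BA; apply: AW1.
  - by move=> x y /BA Ax /BA; apply: nA.
  - by move=> x y /BA; apply: nW.
  - by exists w.
(* Since [a] normalizes [B], [ad a] preserves the vectors of [W] that [B] sends into [W1]. *)
have Uiter j : W (iter j (br a) u) /\ forall b, PB b -> W1 (br b (iter j (br a) u)).
  elim: j => [|j [IW IB]]; first by [].
  split=> /= [|b Bb]; first exact: AW.
  rewrite (br_jacobi Lbr); apply: subspaceD => //; first by apply: IB; apply: Ba.
  by apply: AW1 => //; apply: IB.
(* Some iterate enters [W1]; the one just before the first such iterate is the required vector. *)
have [k0 Hk0] := nW _ _ Aa Wu.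
have exk : exists k, `[< W1 (iter k (br a) u) >].
  by exists k0; apply/asboolP; rewrite Hk0; case: HW1.
case: (ex_minnP exk) => -[|k] /asboolP Hk kmin; first by [].
have [Wk Bk] := Uiter k; exists (iter k (br a) u); split=> //.
  by move=> /asboolP /kmin; rewrite ltnn.
move=> x /AE[b [c [Bb ->]]]; rewrite (brDl Lbr) (brZl Lbr).
by apply: subspaceD => //; [apply: Bk|apply: subspaceZ].
Qed.

(** A subspace [W1] killed by all words of some length grows from 0 to [W]: the vectors that [A]
    sends into [W1] form [W2], strictly larger by [engel_vector] and killed by words one letter
    longer. *)
Theorem engel A W :
  subalgebra br A -> subspace W -> ad_invariant br A W ->
  ad_loc_nilp A A -> ad_loc_nilp A W ->
  exists N, forall ys w, size ys = N -> (forall y, y \in ys -> A y) -> W w ->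
    foldr br w ys = 0.
Proof.
move=> SA HW AW nA nW.
suff H r : forall W1, subspace W1 -> psubset W1 W -> ad_invariant br A W1 ->
   (exists N, forall ys w, size ys = N -> (forall y, y \in ys -> A y) -> W1 w ->
    foldr br w ys = 0) -> (exists2 M : 'M[F]_d, forall x, W1 x <-> (x <= M)%MS &
      (d - \rank M < r)%N) ->
    exists N, forall ys w, size ys = N -> (forall y, y \in ys -> A y) -> W w ->
    foldr br w ys = 0.
  apply: (H d.+1 (fun x => x = 0)).
  - by split=> // a x y -> ->; rewrite scaler0 addr0.
  - by move=> x ->; case: HW.
  - by move=> x y _ ->; rewrite (br0r Lbr).
  - by exists 0%N => -[|//] w _ _ ->.
  - exists 0; last by rewrite ltnS leq_subr.
    by move=> x; rewrite submx0; split=> /eqP.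
elim: r => [|r IH] W1 HW1 W1W AW1 [N HN] [M HM rM]; first by [].
have [[w Hw]|nw] := pselect (exists w, W w /\ ~ W1 w); last first.
  exists N => ys w sys Hys Ww; apply: HN => //.
  by apply: contrapT => W1w; apply: nw; exists w.
have [u [Wu W1u Au]] := engel_vector SA HW AW HW1 AW1 nA nW (ex_intro _ w Hw).
pose W2 x := W x /\ forall a, A a -> W1 (br a x).
have HW2 : subspace W2.
  split; first by split=> [|a _]; [case: HW|rewrite (br0r Lbr); case: HW1].
  move=> c x y [Wx Ax] [Wy Ay]; split; first by apply: HW.2.
  move=> a Aa; rewrite (brDr Lbr) (brZr Lbr).
  by apply: HW1.2; [apply: Ax|apply: Ay].
have W12 x : W1 x -> W2 x by move=> W1x; split=> [|a Aa]; [apply: W1W|apply: AW1].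
have [M2 HM2] := subspace_rowspace HW2.
apply: (IH W2) => //; first by move=> x [].
- by move=> a x Aa [Wx Ax]; apply/W12/Ax.
(* The last letter of a word acts first, so it is the one that moves [W2] into [W1]. *)
- exists N.+1 => ys w'; case/lastP: ys => [//|ys y]; rewrite size_rcons => -[sys] Hys.
  move=> [_ Aw']; rewrite foldr_rcons; apply: HN => //.
    by move=> z zys; apply: Hys; rewrite mem_rcons in_cons zys orbT.
  by apply: Aw'; apply: Hys; rewrite mem_rcons mem_head.
- exists M2 => //.
  have : (\rank M < \rank M2)%N.
    apply: (@rowspace_ltn _ _ u) => [x /HM /W12 /HM2//||].
      by apply/HM2; split.
    by apply/negP => /HM.
  by have := rank_leq_col M2; move: rM; move: (\rank M) (\rank M2) => p q; lia.
Qed.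

End Engel.

(** * Sums of eigenvectors *)

Section EigenSums.
Variables (F : fieldType) (V : lmodType F).
Implicit Types (T : V -> V) (W : V -> Prop) (l : seq (F * V)).

Definition linear_map T := forall a x y, T (a *: x + y) = a *: T x + T y.

Definition eigen_list T l := forall p, p \in l -> T p.2 = p.1 *: p.2.

Section LinearMap.
Variable T : V -> V.
Hypothesis HT : linear_map T.

Lemma linear_map0 : T 0 = 0.
Proof. by have := HT (-1) 0 0; rewrite scaler0 addr0 scaleN1r addNr. Qed.

Lemma linear_mapD x y : T (x + y) = T x + T y.
Proof. by rewrite -{1}[x]scale1r HT scale1r. Qed.

Lemma linear_mapZ a x : T (a *: x) = a *: T x.
Proof. by rewrite -[a *: x]addr0 HT linear_map0 addr0. Qed.

Lemma linear_mapB x y : T (x - y) = T x - T y.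
Proof. by rewrite linear_mapD -scaleN1r linear_mapZ scaleN1r. Qed.

Lemma linear_map_sum (I : Type) (r : seq I) (P : pred I) (f : I -> V) :
  T (\sum_(i <- r | P i) f i) = \sum_(i <- r | P i) T (f i).
Proof.
by elim/big_rec2: _ => [|i x y _ <-]; [exact: linear_map0|rewrite linear_mapD].
Qed.

Lemma linear_map_iter k : linear_map (iter k T).
Proof. by elim: k => [|k IH] a x y //=; rewrite IH HT. Qed.

Lemma linear_map_shift c : linear_map (fun x => T x - c *: x).
Proof.
by move=> a x y; rewrite HT scalerDr scalerA mulrC -scalerA opprD addrACA -scalerBr.
Qed.

End LinearMap.

Lemma subspace_eigen_sum T W : linear_map T -> subspace W ->
  subspace (fun y => exists l : seq (F * V),
    (forall p, p \in l -> W p.2 /\ T p.2 = p.1 *: p.2) /\ y = \sum_(p <- l) p.2).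
Proof.
move=> HT HW; split; first by exists [::]; rewrite big_nil.
move=> a x y [lx [Hx ->]] [ly [Hy ->]].
exists ([seq (p.1, a *: p.2) | p <- lx] ++ ly); split.
  move=> p; rewrite mem_cat => /orP[/mapP[q /Hx[q1 q2] ->]|/Hy//].
  split=> /=; first exact: (subspaceZ _ HW).
  by rewrite (linear_mapZ HT) q2 !scalerA mulrC.
by rewrite big_cat big_map scaler_sumr.
Qed.

(** [T - c] rescales every entry and annihilates those of eigenvalue [c]. With [c] the first
    eigenvalue the list loses its head, which drives the inductions below. *)
Lemma eigen_list_shift T c l : linear_map T -> eigen_list T l ->
  eigen_list T [seq (p.1, (p.1 - c) *: p.2) | p <- l] /\
  T (\sum_(p <- l) p.2) - c *: (\sum_(p <- l) p.2) =
  \sum_(p <- [seq (p.1, (p.1 - c) *: p.2) | p <- l]) p.2.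
Proof.
move=> HT Hl; split.
  move=> _ /mapP[p /Hl pE ->] /=.
  by rewrite (linear_mapZ HT) pE !scalerA mulrC.
rewrite big_map (linear_map_sum HT) scaler_sumr -sumrB; apply: eq_big_seq => p /Hl ->.
by rewrite scalerBl.
Qed.

(** Induction on the length, repeated eigenvalues being allowed. If the first eigenvalue [p.1] is
    nonzero, [(T - p.1) y] is a shorter sum killed by [iter k T], hence by [T]. So
    [T (T y) = p.1 *: T y], and a power of the nonzero [p.1] annihilates [T y]. *)
Lemma eigen_sum_ker T l k : linear_map T -> eigen_list T l ->
  iter k T (\sum_(p <- l) p.2) = 0 -> T (\sum_(p <- l) p.2) = 0.
Proof.
move=> HT; have [n] := ubnP (size l); elim: n l k => // n IH [|p l] k sl Hl Hk.
  by rewrite big_nil (linear_map0 HT).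
have Hl' : eigen_list T l by move=> q ql; apply: Hl; rewrite in_cons ql orbT.
have Hp : T p.2 = p.1 *: p.2 by apply: Hl; rewrite mem_head.
have Tk := linear_map_iter HT k.
have [p0|pn0] := eqVneq p.1 0.
  move: Hk; rewrite big_cons (linear_mapD HT) (linear_mapD Tk) Hp p0 scale0r add0r.
  case: k Tk => [|k] Tk.
    move=> /= Hk; have := linear_mapD HT p.2 (\sum_(q <- l) q.2).
    by rewrite Hk (linear_map0 HT) Hp p0 scale0r add0r => <-.
  rewrite iterSr Hp p0 scale0r (linear_map0 (linear_map_iter HT k)) add0r.
  exact: IH.
set y := \sum_(q <- _) q.2 in Hk *.
have [Hz Ez] := eigen_list_shift p.1 HT Hl; rewrite -/y in Ez.
have Tz : T (T y - p.1 *: y) = 0.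
  rewrite Ez big_map big_cons subrr scale0r add0r.
  rewrite (_ : \sum_(j <- l) _ =
    \sum_(q <- [seq (q.1, (q.1 - p.1) *: q.2) | q <- l]) q.2); last by rewrite big_map.
  apply: (IH _ k); first by rewrite size_map.
    by move=> q ql; apply: Hz; rewrite /= in_cons ql orbT.
  move: Ez; rewrite /= big_cons subrr scale0r add0r => <-.
  by rewrite (linear_mapB Tk) (linear_mapZ Tk) -iterSr iterS Hk (linear_map0 HT)
    scaler0 subr0.
have TTy : T (T y) = p.1 *: T y.
  by apply/eqP; rewrite -subr_eq0 -(linear_mapZ HT) -(linear_mapB HT) Tz.
have Tj j : iter j T (T y) = p.1 ^+ j *: T y.
  elim: j => [|j IHj]; first by rewrite scale1r.
  by rewrite iterS IHj (linear_mapZ HT) TTy scalerA exprSr.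
have := Tj k; rewrite -iterSr iterS Hk (linear_map0 HT) => /esym/eqP.
by rewrite scaler_eq0 expf_eq0 (negPf pn0) andbF => /eqP.
Qed.

(** By induction [(T - p.1) y] is a sum of eigenvectors in [W]. Dividing those with eigenvalue
    [c != p.1] by [c - p.1] and subtracting them from [y] leaves [y'] killed by the square of
    [T - p.1]. As [y'] is still a sum of eigenvectors, [eigen_sum_ker] makes it an eigenvector for
    [p.1]. *)
Lemma eigen_sum_invariant T W l : linear_map T -> subspace W ->
  (forall x, W x -> W (T x)) -> eigen_list T l -> W (\sum_(p <- l) p.2) ->
  exists l', [/\ eigen_list T l', (forall p, p \in l' -> W p.2) &
    \sum_(p <- l) p.2 = \sum_(p <- l') p.2].
Proof.
move=> HT HW WT; have [n] := ubnP (size l); elim: n l => // n IH [|p l] sl Hl Wy.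
  by exists [::].
set y := \sum_(q <- _) q.2 in Wy *.
have [Hz Ez] := eigen_list_shift p.1 HT Hl; rewrite -/y in Ez.
pose l0 := [seq (q.1, (q.1 - p.1) *: q.2) | q <- l].
have {}Ez : T y - p.1 *: y = \sum_(q <- l0) q.2.
  by rewrite Ez /= big_cons subrr scale0r add0r.
have Hl0 : eigen_list T l0 by move=> q ql; apply: Hz; rewrite /= in_cons ql orbT.
have Wz : W (\sum_(q <- l0) q.2).
  by rewrite -Ez; apply: (subspaceB HW); [apply: WT|apply: (subspaceZ _ HW)].
have [|l1 [Hl1 Wl1 El1]] := IH l0 _ Hl0 Wz; first by rewrite size_map.
pose l2 := [seq (q.1, (q.1 - p.1)^-1 *: q.2) | q <- l1 & q.1 != p.1].
have Hl2 : eigen_list T l2.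
  move=> _ /mapP[q + ->]; rewrite mem_filter => /andP[_ /Hl1 qE] /=.
  by rewrite (linear_mapZ HT) qE !scalerA mulrC.
have Wl2 q : q \in l2 -> W q.2.
  move=> /mapP[r + ->]; rewrite mem_filter => /andP[_ /Wl1 Wr] /=.
  exact: (subspaceZ _ HW).
pose y' := y - \sum_(q <- l2) q.2.
have Wy' : W y'.
  apply: (subspaceB HW) => //; rewrite big_seq; apply: (subspace_sum _ HW) => q.
  exact: Wl2.
have Ty' : T y' = p.1 *: y'.
  pose T' x := T x - p.1 *: x.
  have HT' : linear_map T' by apply: linear_map_shift.
  pose l3 := [seq (q.1 - p.1, q.2) | q <- p :: l] ++
             [seq (q.1 - p.1, - q.2) | q <- l2].
  have y'E : y' = \sum_(q <- l3) q.2.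
    by rewrite /y' /l3 big_cat [X in _ = X + _]big_map [X in _ = _ + X]big_map sumrN.
  have Hl3 : eigen_list T' l3.
    move=> q; rewrite mem_cat => /orP[] /mapP[r].
      by move=> /Hl rE ->; rewrite /T' /= rE scalerBl.
    move=> /Hl2 rE -> /=; rewrite -scaleN1r (linear_mapZ HT') /T' rE.
    by rewrite -scalerBl !scalerA mulrC.
  have T'y' : T' y' = \sum_(q <- l1 | q.1 == p.1) q.2.
    rewrite /y' (linear_mapB HT') /T' Ez El1.
    rewrite (bigID (fun q => q.1 == p.1)) /= -[RHS]addr0 -addrA; congr (_ + _).
    apply/eqP; rewrite subr_eq0; apply/eqP.
    rewrite big_map big_filter (linear_map_sum HT) scaler_sumr -sumrB.
    rewrite [LHS]big_seq_cond [RHS]big_seq_cond.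
    apply: eq_bigr => q /andP[/Hl1 qE qp].
    rewrite (linear_mapZ HT) qE !scalerA mulrC -scalerBl -mulrBl mulfV ?scale1r //.
    by rewrite subr_eq0.
  have /eqP : T' y' = 0.
    rewrite y'E; apply: (@eigen_sum_ker _ _ 2) => //; rewrite -y'E /= T'y'.
    rewrite (linear_map_sum HT') big_seq_cond big1 // => q /andP[/Hl1 qE /eqP qp].
    by rewrite /T' qE qp subrr.
  by rewrite subr_eq0 => /eqP.
exists ((p.1, y') :: l2); split.
- by move=> q; rewrite in_cons => /orP[/eqP -> //|/Hl2].
- by move=> q; rewrite in_cons => /orP[/eqP -> //|/Wl2].
- by rewrite big_cons /= subrK.
Qed.

(** Induction on [i + j]: one application of the difference gives [T1 x], killed one step earlier by
    [T1], minus [T2 x], killed one step earlier by [T2]. *)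
Lemma iter_commuting_sub T1 T2 i j x : linear_map T1 -> linear_map T2 ->
  (forall y, T1 (T2 y) = T2 (T1 y)) ->
  iter i T1 x = 0 -> iter j T2 x = 0 -> iter (i + j) (fun y => T1 y - T2 y) x = 0.
Proof.
move=> H1 H2 C; have H : linear_map (fun y => T1 y - T2 y).
  by move=> a y z; rewrite H1 H2 opprD addrACA -scalerBr.
have Ci k T T' y : (forall y, T (T' y) = T' (T y)) -> iter k T (T' y) = T' (iter k T y).
  by move=> TT; elim: k => //= k ->.
move: {2}(i + j)%N (leqnn (i + j)) => n.
elim: n i j x => [|n IH] i j x.
  by rewrite leqn0 addn_eq0 => /andP[/eqP -> /eqP ->].
case: i => [|i] ijn Hi Hj.
  by rewrite (_ : x = 0) // (linear_map0 (linear_map_iter H _)).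
case: j ijn Hj => [|j] ijn Hj.
  by rewrite (_ : x = 0) // (linear_map0 (linear_map_iter H _)).
rewrite addSn iterSr (linear_mapB (linear_map_iter H _)) IH; first last.
- by rewrite Ci // Hj (linear_map0 H1).
- by rewrite -iterSr.
- by lia.
rewrite addnS -addSn IH ?subrr //; first by lia.
  by rewrite Ci // Hi (linear_map0 H2).
by rewrite -iterSr.
Qed.

End EigenSums.

(** * Derivations *)

Section SpectralFunction.
Variables (F : closedFieldType) (d : nat) (M : 'M[F]_d) (e : nat).
Variables (rs : seq F) (P : F -> 'M[F]_d).
Hypothesis HP : spectral_family M e rs P.

(** The function [phi] of the semisimple part of [M]; the identity function gives that part
    itself. *)
Definition spectral_fun (phi : F -> F) : 'M[F]_d := \sum_(c <- rs) phi c *: P c.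

Lemma spectral_decomp (u : 'rV_d) : u = \sum_(c <- rs) u *m P c.
Proof. by case: HP => _ P1 _ _ _; rewrite -mulmx_sumr P1 mulmx1. Qed.

Lemma spectral_fun_eigen phi c (u : 'rV_d) : c \in rs -> u *m P c = u ->
  u *m spectral_fun phi = phi c *: u.
Proof.
case: HP => Urs _ _ _ [PP _ _] crs uP.
rewrite -uP -mulmxA mulmx_sumr (bigD1_seq c) //= big1_seq => [|b /andP[bc _]].
  by rewrite addr0 -scalemxAr PP eqxx -scalemxAr.
by rewrite -scalemxAr PP eq_sym (negPf bc) scaler0.
Qed.

Lemma spectral_proj_eigen c (u : 'rV_d) : u *m P c *m P c = u *m P c.
Proof. by case: HP => _ _ _ _ [PP _ _]; rewrite -mulmxA PP eqxx. Qed.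

(** [M *m P c] differs from [c *: P c] by a nilpotent matrix; the rank is the algebraic multiplicity
    of [c]. *)
Lemma mxtrace_spectral c : \tr (M *m P c) = c * (\rank (P c))%:R.
Proof.
case: HP => _ _ PM _ [PP PC _].
have PMc : P c *m M = M *m P c by rewrite -PC.
have -> : M *m P c = c *: P c + (M - c%:M) *m P c.
  by rewrite mulmxBl mul_scalar_mx addrC subrK.
rewrite mxtraceD mxtraceZ mxtrace_idem; last by rewrite PP eqxx.
rewrite (@mxtrace_nilpotent _ _ _ d.+1) ?addr0 //.
have cP : GRing.comm (M - c%:M) (P c).
  by rewrite /GRing.comm -!mulmxE mulmxBl mulmxBr PMc scalar_mxC.
rewrite mulmxE exprMn_comm // exprS exprSr -mulrA.
have -> : (M - c%:M) ^+ d * (P c ^+ d * P c) = P c ^+ d * (P c * (M - c%:M) ^+ d).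
  have cd : GRing.comm ((M - c%:M) ^+ d) (P c).
    by apply/commr_sym/commrX/commr_sym.
  by rewrite -exprSr (commrX _ cd) exprSr -mulrA.
by have := PM c; rewrite mulmxE => ->; rewrite !mulr0.
Qed.

Lemma spectral_nilpotent : (forall c, c \in rs -> c != 0 -> P c = 0) -> M ^+ d = 0.
Proof.
move=> P0; case: HP => _ P1 PM _ _.
rewrite -[M ^+ d]mul1r -[1]/(1%:M) -P1 -mulmxE mulmx_suml big1_seq // => c crs.
have [c0|cn0] := eqVneq c 0; last by rewrite P0 // mul0mx.
by have := PM c; rewrite c0 raddf0 subr0.
Qed.

Lemma mxtrace_spectral_fun phi :
  \tr (M *m spectral_fun phi) = \sum_(c <- rs) phi c * c * (\rank (P c))%:R.
Proof.
rewrite mulmx_sumr raddf_sum; apply: eq_bigr => c _ /=.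
by rewrite -scalemxAr mxtraceZ mxtrace_spectral mulrA.
Qed.

End SpectralFunction.

(** * Adjoint matrices and derivations *)

Section AdMatrix.
Variables (F : closedFieldType) (d : nat).
Variable br : 'rV[F]_d -> 'rV[F]_d -> 'rV[F]_d.
Hypothesis Lbr : is_lie_bracket br.

(** Vectors are rows, so matrices act on the right and products compose in reverse order; hence the
    signs in [ad_mx_br]. *)
Definition ad_mx x : 'M[F]_d := \matrix_i br x (delta_mx 0 i).

Lemma mul_ad_mx x u : u *m ad_mx x = br x u.
Proof.
rewrite mulmx_sum_row [u in RHS]row_sum_delta (br_sumr Lbr).
by apply: eq_bigr => i _; rewrite rowK (brZr Lbr).
Qed.

Lemma eq_row_mulmx (A B : 'M[F]_d) : (forall u : 'rV_d, u *m A = u *m B) -> A = B.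
Proof. by move=> H; apply/row_matrixP => i; rewrite !rowE. Qed.

Lemma ad_mxD x y : ad_mx (x + y) = ad_mx x + ad_mx y.
Proof. by apply: eq_row_mulmx => u; rewrite mulmxDr !mul_ad_mx (brDl Lbr). Qed.

Lemma ad_mxZ a x : ad_mx (a *: x) = a *: ad_mx x.
Proof. by apply: eq_row_mulmx => u; rewrite -scalemxAr !mul_ad_mx (brZl Lbr). Qed.

Lemma ad_mx_sum (I : Type) (r : seq I) (f : I -> 'rV_d) :
  ad_mx (\sum_(i <- r) f i) = \sum_(i <- r) ad_mx (f i).
Proof.
by apply: eq_row_mulmx => u; rewrite mulmx_sumr mul_ad_mx (br_suml Lbr);
  apply: eq_bigr => i _; rewrite mul_ad_mx.
Qed.

Lemma iter_ad_mx k x u : iter k (br x) u = u *m ad_mx x ^+ k.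
Proof.
elim: k => [|k IH] /=; first by rewrite expr0 mulmx1.
by rewrite IH -mul_ad_mx exprSr -mulmxE mulmxA.
Qed.

Definition derivation (D : 'M[F]_d) :=
  forall u v, br u v *m D = br (u *m D) v + br u (v *m D).

Lemma derivation_ad x : derivation (ad_mx x).
Proof. by move=> u v; rewrite !mul_ad_mx (br_jacobi Lbr). Qed.

Lemma derivationB D E : derivation D -> derivation E -> derivation (D - E).
Proof.
move=> HD HE u v; rewrite !mulmxBr HD HE (brBl Lbr) (brBr Lbr) opprD.
by rewrite addrACA.
Qed.

(** Leibniz rule: [D - (a + b)] acts on a bracket as [D - a] on the left factor plus [D - b] on the
    right one; then induction on [i + j]. *)
Lemma derivation_geigen D a b i j u v : derivation D ->
  u *m (D - a%:M) ^+ i = 0 -> v *m (D - b%:M) ^+ j = 0 ->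
  br u v *m (D - (a + b)%:M) ^+ (i + j) = 0.
Proof.
move=> HD; move: {2}(i + j)%N (leqnn (i + j)) => n.
elim: n i j u v => [|n IH] i j u v.
  rewrite leqn0 addn_eq0 => /andP[/eqP -> /eqP ->].
  by rewrite expr0 mulmx1 => -> _; rewrite (br0l Lbr) mul0mx.
case: i => [|i]; first by rewrite expr0 mulmx1 => _ -> _; rewrite (br0l Lbr) mul0mx.
case: j => [|j]; first by rewrite expr0 mulmx1 => _ _ ->; rewrite (br0r Lbr) mul0mx.
move=> ijn Hu Hv.
have Hu' : u *m (D - a%:M) *m (D - a%:M) ^+ i = 0 by rewrite -mulmxA mulmxE -exprS.
have Hv' : v *m (D - b%:M) *m (D - b%:M) ^+ j = 0 by rewrite -mulmxA mulmxE -exprS.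
rewrite addSn exprS -mulmxE mulmxA.
have -> : br u v *m (D - (a + b)%:M) =
    br (u *m (D - a%:M)) v + br u (v *m (D - b%:M)).
  rewrite !mulmxBr HD !mul_mx_scalar (brBl Lbr) (brBr Lbr) (brZl Lbr) (brZr Lbr).
  by rewrite addrACA -opprD -scalerDl.
rewrite mulmxDl IH //.
by rewrite add0r addnS -addSn IH //; lia.
Qed.

(** By bilinearity only brackets of generalized eigenvectors for [a] and [b] matter. The power
    [d + d] of [M - (a + b)] kills them, whence the bound on [e], and they are then fixed by
    [P (a + b)], whether or not [a + b] is an eigenvalue. *)
Lemma derivation_spectral_fun M e (zs rs : seq F) P phi :
  derivation M -> spectral_family M e rs P -> (d + d <= e)%N ->
  {subset zs <= rs} ->
  (forall c, c \in rs -> c \notin zs -> P c = 0) ->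
  (forall a b, a \in zs -> b \in zs -> a + b \in rs /\ phi (a + b) = phi a + phi b) ->
  derivation (spectral_fun rs P phi).
Proof.
move=> DM HP de zrs P0 Hphi u v.
have dec := spectral_decomp HP; have [Urs _ PM PE _] := HP.
set D := spectral_fun rs P phi.
have Deig c (x : 'rV_d) : c \in rs -> x *m P c = x -> x *m D = phi c *: x.
  exact: (spectral_fun_eigen HP).
pose Q x y := br x y *m D = br (x *m D) y + br x (y *m D).
have Qr x : subspace (Q x).
  split; first by rewrite /Q !mul0mx !(br0r Lbr) mul0mx addr0.
  move=> c y z Hy Hz; rewrite /Q mulmxDl -scalemxAl !(brDr Lbr) !(brZr Lbr).
  by rewrite mulmxDl -scalemxAl Hy Hz scalerDr addrACA.
have Ql y : subspace (Q^~ y).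
  split; first by rewrite /Q !mul0mx !(br0l Lbr) mul0mx addr0.
  move=> c x z Hy Hz; rewrite /Q mulmxDl -scalemxAl !(brDl Lbr) !(brZl Lbr).
  by rewrite mulmxDl -scalemxAl Hy Hz scalerDr addrACA.
rewrite -/(Q u v) [u]dec big_seq; apply: (subspace_sum _ (Ql v)) => a ars.
have [azs|aNzs] := boolP (a \in zs); last first.
  by rewrite (P0 a) // mulmx0; case: (Ql v).
rewrite [v]dec big_seq; apply: (subspace_sum _ (Qr _)) => b brs.
have [bzs|bNzs] := boolP (b \in zs); last first.
  by rewrite (P0 b) // mulmx0; case: (Qr (u *m P a)).
have [abrs phiab] := Hphi _ _ azs bzs.
rewrite /Q (Deig a (u *m P a)) ?(spectral_proj_eigen HP) //.
rewrite (Deig b (v *m P b)) ?(spectral_proj_eigen HP) //.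
rewrite (brZl Lbr) (brZr Lbr) -scalerDl -phiab; apply: Deig => //.
apply: (PE _ (d + d)%N) => //; apply: derivation_geigen => //.
  by rewrite -mulmxA PM mulmx0.
by rewrite -mulmxA PM mulmx0.
Qed.

Lemma ad_mx_br x y : ad_mx (br x y) = ad_mx y *m ad_mx x - ad_mx x *m ad_mx y.
Proof.
apply: eq_row_mulmx => u; rewrite mulmxBr !mulmxA !mul_ad_mx (br_jacobi Lbr x y).
by rewrite addrK.
Qed.

(** Cyclicity of the trace moves the commutator with [ad x] onto [D]. This is applied to [D]
    commuting with [ad x] and to derivations [D]. *)
Lemma mxtrace_ad_br x y (D : 'M[F]_d) :
  \tr (ad_mx (br x y) *m D) = \tr (ad_mx y *m (ad_mx x *m D - D *m ad_mx x)).
Proof.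
rewrite ad_mx_br mulmxBl mulmxBr !raddfB /= -!mulmxA; congr (_ - _).
by rewrite mxtrace_mulC -!mulmxA.
Qed.

Lemma ad_mx_derivation D x : derivation D ->
  ad_mx x *m D - D *m ad_mx x = ad_mx (x *m D).
Proof.
move=> HD; apply: eq_row_mulmx => u.
by rewrite mulmxBr !mulmxA !mul_ad_mx HD addrK.
Qed.

End AdMatrix.

(** * Extending Jordan decompositions *)

Section JordanExtension.
Variables (F : closedFieldType) (charF0 : [pchar F] =i pred0) (d : nat).
Variable br : 'rV[F]_d -> 'rV[F]_d -> 'rV[F]_d.
Hypothesis Lbr : is_lie_bracket br.
Local Notation ad := (ad_mx br).
Local Notation total := (fun _ : 'rV[F]_d => True).

Lemma natf_eq0 n : (n%:R == 0 :> F) = (n == 0%N).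
Proof. by move/pcharf0P: charF0. Qed.

(* On the generalized eigenspace of a nonzero eigenvalue, [m] has nonzero
   trace; but that eigenspace is [A]-stable and [m] is a sum of commutators. *)
Lemma ad_nilp_on_total (A : 'rV_d -> Prop) m :
  in_derived br A m -> ad_nilp_on br A m -> ad_nilp_on br total m.
Proof.
move=> [l [lA El]] [k mk].
have [zs [rs [P [_ _ _ HP]]]] :=
  spectral_family_exists (ad m) (k + d)%N (fun=> [::]).
have [Urs P1 PM PE [PP PC _]] := HP.
exists d => y _; rewrite (iter_ad_mx Lbr) (spectral_nilpotent HP) ?mulmx0 // => c crs cn0.
(* [ad m] is nilpotent on [A], so [a] is a generalized eigenvector for 0 and [ad a] preserves the
   generalized eigenspaces of [ad m]; the exponents [k] and [d] add up. *)
have Pcomm a : A a -> ad a *m P c - P c *m ad a = 0.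
  move=> Aa; apply/eqP; rewrite subr_eq0; apply/eqP/eq_row_mulmx => u.
  rewrite !mulmxA !(mul_ad_mx Lbr) {1}[u](spectral_decomp HP) (br_sumr Lbr).
  rewrite mulmx_suml (bigD1_seq c) //= big1_seq ?addr0 => [|b /andP[bc brs]].
    rewrite (PE c (k + d)%N) // -[c in X in _ *m X]add0r.
    apply: (derivation_geigen Lbr) => //; first exact: derivation_ad.
      by rewrite raddf0 subr0 -(iter_ad_mx Lbr) mk.
    by rewrite -mulmxA PM mulmx0.
  rewrite -[br a _](PE b (k + d)%N) // -?mulmxA ?PP ?(negPf bc) ?mulmx0 //.
  rewrite -[b in X in _ *m X]add0r.
  apply: (derivation_geigen Lbr) => //; first exact: derivation_ad.
    by rewrite raddf0 subr0 -(iter_ad_mx Lbr) mk.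
  by rewrite -mulmxA PM mulmx0.
have := mxtrace_spectral HP c.
rewrite {1}El (ad_mx_sum Lbr) mulmx_suml raddf_sum /= big1_seq => [|p /andP[_ /lA[p1 p2]]].
  by move/esym/eqP; rewrite mulf_eq0 (negPf cn0) natf_eq0 mxrank_eq0 => /eqP.
by rewrite (mxtrace_ad_br Lbr) Pcomm // mulmx0 mxtrace0.
Qed.

Lemma ad_diag_on_total (A : 'rV_d -> Prop) s :
  reductive_in br A total -> subspace A -> A s ->
  ad_diag_on br A s -> ad_diag_on br total s.
Proof.
move=> Ared SA As sA.
pose W y := exists l : seq (F * 'rV[F]_d),
  (forall p, p \in l -> True /\ br s p.2 = p.1 *: p.2) /\ y = \sum_(p <- l) p.2.
have Weig c y : br s y = c *: y -> W y.
  by move=> Hy; exists [:: (c, y)]; rewrite big_seq1; split=> // p /[!inE] /eqP ->.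
have SW : subspace W.
  by apply: (subspace_eigen_sum (W := total)) => // a x z; case: Lbr => _ [].
(* Eigenvectors of [ad s] span [A], and bracketing adds eigenvalues. *)
have AW : ad_invariant br A W.
  move=> x y Ax [ly [Hy ->]]; have [lx [Hx ->]] := sA x Ax.
  rewrite (br_suml Lbr) big_seq; apply: subspace_sum => // p /Hx[_ Hp].
  rewrite (br_sumr Lbr) big_seq; apply: subspace_sum => // q /Hy[_ Hq].
  apply: (Weig (p.1 + q.1)); rewrite (br_jacobi Lbr) Hp Hq (brZl Lbr) (brZr Lbr).
  by rewrite -scalerDl.
have [|W' [SW' _ AW' WW' WDW']] := Ared W SW _ AW; first by [].
have [zs [rs [P [_ _ _ HP]]]] := spectral_family_exists (ad s) 0 (fun=> [::]).
have [_ _ PM _ [_ _ PW]] := HP.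
(* The last nonzero vector among the iterates of [ad s - c] on [x] would be an eigenvector in [W'],
   hence in both [W] and [W']; [W'] is stable because [s] lies in [A]. *)
have W'0 c k x : W' x -> x *m (ad s - c%:M) ^+ k = 0 -> x = 0.
  elim: k x => [|k IH] x W'x; first by rewrite expr0 mulmx1.
  rewrite exprS -mulmxE mulmxA => /IH Hx; apply: WW' => //; apply: (Weig c).
  apply/eqP; rewrite -subr_eq0 -mul_mx_scalar -(mul_ad_mx Lbr) -mulmxBr Hx //.
  rewrite mulmxBr mul_mx_scalar (mul_ad_mx Lbr).
  by apply: (subspaceB SW'); [apply: AW'|apply: (subspaceZ _ SW')].
move=> y _; have [y1 [y2 [Wy1 W'y2 ->]]] := WDW' y I.
suff -> : y2 = 0 by rewrite addr0.
rewrite [y2](spectral_decomp HP) big1 // => c _; apply: (W'0 c d).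
  by apply: PW => // w W'w; rewrite (mul_ad_mx Lbr); apply: AW'.
by rewrite -mulmxA PM mulmx0.
Qed.

Lemma jordan_in_total (A : 'rV_d -> Prop) X s m :
  reductive_in br A total -> subspace A -> jordan_in br A X s m ->
  jordan_in br total X s m.
Proof.
move=> Ared SA [As Am XE sm [sA mA dA]]; split=> //; split.
- exact: ad_diag_on_total sA.
- exact: ad_nilp_on_total mA.
- exact: in_derivedS dA.
Qed.

End JordanExtension.

(** * Rational functionals *)

Section RationalFunctionals.
Import Num.Theory.
Variables (F : fieldType) (charF0 : [pchar F] =i pred0).

Lemma intr_eq0_pchar0 (z : int) : (z%:~R == 0 :> F) = (z == 0).
Proof.
have nat0 n : (n%:R == 0 :> F) = (n == 0%N) by move/pcharf0P: charF0.
case: z => n; first by rewrite -pmulrn nat0.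
by rewrite NegzE mulrNz oppr_eq0 -pmulrn nat0.
Qed.

(** [ratr] reads a fraction in lowest terms; cross-multiplication in [int] compares it with any
    other representative. *)
Lemma ratr_frac (a b : int) : b != 0 ->
  ratr (a%:~R / b%:~R) = a%:~R / b%:~R :> F.
Proof.
move=> b0; set x : rat := _ / _.
have b0q : b%:~R != 0 :> rat by rewrite intr_eq0.
have d0q : (denq x)%:~R != 0 :> rat by rewrite intr_eq0 denq_neq0.
have E : numq x * b = a * denq x.
  apply/eqP; rewrite -(eqr_int rat) !intrM -[(numq x)%:~R](divfK d0q) divq_num_den.
  by rewrite mulrAC /x divfK.
apply/eqP; rewrite /ratr eqr_div ?intr_eq0_pchar0 ?denq_neq0 //.
by rewrite -!intrM E.
Qed.

Lemma ratrD_pchar0 (x y : rat) : ratr (x + y) = ratr x + ratr y :> F.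
Proof.
have dx : (denq x)%:~R != 0 :> rat by rewrite intr_eq0 denq_neq0.
have dy : (denq y)%:~R != 0 :> rat by rewrite intr_eq0 denq_neq0.
have -> : x + y = (numq x * denq y + numq y * denq x)%:~R / (denq x * denq y)%:~R.
  by rewrite -{1}[x]divq_num_den -{1}[y]divq_num_den addf_div // !(intrD, intrM).
rewrite ratr_frac ?mulf_neq0 ?denq_neq0 // /ratr.
by rewrite addf_div ?intr_eq0_pchar0 ?denq_neq0 // !(intrD, intrM).
Qed.

Lemma ratrM_pchar0 (x y : rat) : ratr (x * y) = ratr x * ratr y :> F.
Proof.
have -> : x * y = (numq x * numq y)%:~R / (denq x * denq y)%:~R.
  by rewrite -{1}[x]divq_num_den -{1}[y]divq_num_den mulf_div !intrM.
by rewrite ratr_frac ?mulf_neq0 ?denq_neq0 // /ratr mulf_div !intrM.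
Qed.

(* Over the rationals, the space of linear relations between the entries of
   [rs] equals its double orthogonal; a functional killing it is additive. *)
Lemma additive_functional_separation (rs : seq F) (n : F -> nat) : uniq rs ->
  (forall f : F -> rat,
     (forall a b, a \in rs -> b \in rs -> a + b \in rs -> f (a + b) = f a + f b) ->
     \sum_(c <- rs) ratr (f c) * c * (n c)%:R = 0) ->
  forall c, c \in rs -> n c != 0%N -> c = 0.
Proof.
move=> Urs Hf; pose N := size rs.
(* The kernel of [L] consists of the rational relations between the entries of [rs]; below, [C] is a
   matrix with that same kernel. *)
pose L (v : 'rV[rat]_N) : F := \sum_i ratr (v 0 i) * rs`_i.
have [B HB] : exists B : 'M[rat]_N, forall v, L v = 0 <-> (v <= B)%MS.
  apply: (@subspace_rowspace _ _ (fun v => L v = 0)); split.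
    by rewrite /L big1 // => i _; rewrite mxE /ratr mul0r mul0r.
  move=> a x y Lx Ly; rewrite /L.
  under eq_bigr => i _ do rewrite !mxE ratrD_pchar0 ratrM_pchar0 mulrDl -mulrA.
  by rewrite big_split /= -mulr_sumr -/(L x) -/(L y) Lx Ly mulr0 addr0.
pose C := cokermx B.
have LC v : L v = 0 <-> v *m C = 0 by rewrite HB submxE; split=> /eqP.
move: C LC => C LC.
have Lnat (k : nat) : ratr (k%:R : rat) = k%:R :> F by rewrite ratr_nat.
have Ld i : L (delta_mx 0 i) = rs`_i.
  rewrite /L (bigD1 i) //= big1 => [|j ji]; first by rewrite mxE !eqxx Lnat mul1r addr0.
  by rewrite mxE (negPf ji) andbF Lnat mul0r.
have LD v w : L (v + w) = L v + L w.
  rewrite /L -big_split; apply: eq_bigr => i _ /=.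
  by rewrite mxE ratrD_pchar0 mulrDl.
have LN v : L (- v) = - L v.
  by apply/eqP; rewrite -addr_eq0 addrC -LD subrr /L big1 // => i _; rewrite mxE /ratr !mul0r.
(* Column [j] of [C] as a function on [rs]. It is additive because [C] kills the relation expressing
   an entry as the sum of two others. *)
pose f j c : rat := \sum_(i < N | rs`_i == c) C i j.
have fE j (i : 'I_N) : f j rs`_i = C i j.
  rewrite /f (bigD1 i) //= big1 ?addr0 // => k /andP[/eqP ki /negP[]].
  by apply/eqP/val_inj/eqP; rewrite -(nth_uniq 0 _ _ Urs) ?ltn_ord // ki.
have fadd j a b : a \in rs -> b \in rs -> a + b \in rs ->
    f j (a + b) = f j a + f j b.
  have toi c : c \in rs -> exists i : 'I_N, c = rs`_i.
    by move=> /(nthP 0)[i iN <-]; exists (Ordinal iN).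
  move=> /toi[i ->] /toi[k ->] /toi[l Hl]; rewrite Hl !fE.
  have /LC : L (delta_mx 0 i + delta_mx 0 k - delta_mx 0 l) = 0.
    by rewrite !LD LN !Ld -Hl subrr.
  move/rowP/(_ j); rewrite mulmxBl mulmxDl -!rowE !mxE => /eqP.
  by rewrite subr_eq0 => /eqP.
move=> c /(nthP 0)[i0 iN <-]; pose i := Ordinal iN; rewrite -[i0]/(val i) => nc.
rewrite -Ld; apply/LC; rewrite -rowE; apply/rowP => j; rewrite !mxE.
have := Hf (f j) (fadd j); rewrite (big_nth 0) big_mkord => Hj.
(* The hypothesis on [f j] says that this row is a relation. Pairing it with column [j] of [C] gives
   a vanishing sum of nonnegative terms, squares of the [C k j] times multiplicities, so each term
   is 0. *)
have /LC : L (\row_k (C k j * (n rs`_k)%:R)) = 0.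
  apply: etrans Hj; apply: eq_bigr => k _.
  by rewrite mxE fE ratrM_pchar0 Lnat mulrAC.
move/rowP/(_ j); rewrite !mxE => /eqP.
rewrite psumr_eq0 => [/allP/(_ i)|k _]; last first.
  by rewrite mxE mulrAC -expr2 mulr_ge0 ?sqr_ge0.
rewrite mem_index_enum => /(_ isT) /=; rewrite mxE mulrAC -expr2.
by rewrite mulf_eq0 sqrf_eq0 pnatr_eq0 (negPf nc) orbF => /eqP.
Qed.

End RationalFunctionals.

(** * Existence of Jordan decompositions *)

Section JordanExistence.
Variables (F : closedFieldType) (charF0 : [pchar F] =i pred0) (d : nat).
Variable br : 'rV[F]_d -> 'rV[F]_d -> 'rV[F]_d.
Hypothesis Lbr : is_lie_bracket br.
Local Notation ad := (ad_mx br).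
Local Notation total := (fun _ : 'rV[F]_d => True).
Hypothesis red : reductive_in br total total.
Local Notation derived := (in_derived br total).

Let totalS : subspace total. Proof. by []. Qed.

Let derivedS : subspace derived.
Proof. exact (in_derived_subspace Lbr totalS). Qed.

Definition ideal (I : 'rV[F]_d -> Prop) := subspace I /\ forall x y, I y -> I (br x y).

Lemma ideal_compl I : ideal I -> exists2 J, ideal J &
  (forall x, I x -> J x -> x = 0) /\
  (forall x, exists y z, [/\ I y, J z & x = y + z]).
Proof.
move=> [SI HI]; have [J [SJ _ HJ IJ IDJ]] := red SI (fun _ _ => Logic.I) (fun x y _ => HI x y).
by exists J; split=> //; [move=> x y; apply: HJ|move=> x; apply: IDJ].
Qed.

Lemma ideal_br I x y : ideal I -> I x -> I (br x y).
Proof. by move=> [SI HI] Ix; rewrite (brC Lbr); apply: (subspaceN SI); apply: HI. Qed.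

Lemma ideal_derived : ideal derived.
Proof. by split=> // x y _; apply: in_derived_br. Qed.

(** The center has a complementary ideal [J]. A bracket only sees the [J]-component of its second
    argument, so the derived algebra lies in [J]. *)
Lemma derived_central x : derived x -> (forall y, br x y = 0) -> x = 0.
Proof.
have [|J [SJ HJ] [ZJ ZDJ]] := @ideal_compl (fun x => forall y, br x y = 0).
  split; first by split=> [y|a y z Hy Hz t]; rewrite ?(br0l Lbr) // (brDl Lbr) (brZl Lbr) Hy Hz scaler0 addr0.
  by move=> y z Hz t; rewrite (brC Lbr y z) Hz oppr0 (br0l Lbr).
move=> Dx Zx; apply: ZJ => //; apply: in_derived_sub Dx => // {Zx}x y _ _.
have [a [b [Ha Hb ->]]] := ZDJ y.
by rewrite (brDr Lbr) (brC Lbr x a) Ha oppr0 add0r; apply: HJ.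
Qed.

(** A complementary ideal of the derived algebra is central: its brackets lie both in it and in the
    derived algebra. *)
Lemma derived_decomp x : exists a b, [/\ derived a, (forall y, br b y = 0) & x = a + b].
Proof.
have [J [SJ HJ] [DJ DDJ]] := ideal_compl ideal_derived.
have [a [b [Da Jb ->]]] := DDJ x; exists a, b; split=> // y.
apply: DJ; first exact: in_derived_br.
by apply: ideal_br.
Qed.

(** Let [c] be the component of [x] in a complement of [[I, I]]. Its brackets with [I] lie in
    [[I, I]] and in that complement, those with a complement [J] of [I] in both [I] and [J]. So [c]
    is central in the whole algebra and lies in the derived algebra, hence is 0. *)
Lemma ideal_perfect I x : ideal I -> psubset I derived -> I x -> in_derived br I x.
Proof.
move=> idI ID Ix; have [SI HI] := idI.
have idII : ideal (in_derived br I).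
  have SII := in_derived_subspace Lbr SI.
  split=> // a _ [l [Hl ->]]; rewrite (br_sumr Lbr) big_seq.
  apply: subspace_sum => // p /Hl[p1 p2]; rewrite (br_jacobi Lbr).
  by apply: (subspaceD SII); apply: in_derived_br => //; apply: HI.
have [C idC [IIC IIDC]] := ideal_compl idII.
have [J idJ [IJ IDJ]] := ideal_compl idI.
have [a [c [IIa Cc xE]]] := IIDC x.
have Ic : I c.
  rewrite -[c](addKr a) -xE addrC; apply: (subspaceB SI) => //.
  by apply: in_derived_sub IIa => // p q _; apply: HI.
suff c0 : c = 0 by rewrite xE c0 addr0.
apply: derived_central; first exact: ID.
move=> y; have [i [j [Ii Jj ->]]] := IDJ y; rewrite (brDr Lbr).
rewrite (IIC (br c i)) ?add0r; first last.
- exact: ideal_br.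
- exact: in_derived_br.
by apply: IJ; [apply: ideal_br|apply: idJ.2].
Qed.

Definition killing x y : F := \tr (ad x *m ad y).

Lemma killing_br x y z : killing (br x y) z = killing y (br z x).
Proof. by rewrite /killing (mxtrace_ad_br Lbr) -(ad_mx_br Lbr). Qed.

Definition killing_radical x := derived x /\ forall y, killing x y = 0.

Lemma ideal_killing_radical : ideal killing_radical.
Proof.
split; first split.
- by split=> [|y]; [case: derivedS|rewrite /killing -[X in ad X](scale0r 0) (ad_mxZ Lbr) scale0r mul0mx mxtrace0].
- move=> a x y [Dx Hx] [Dy Hy]; split; first by apply: derivedS.2.
  move=> z; rewrite /killing (ad_mxD Lbr) (ad_mxZ Lbr) mulmxDl -scalemxAl.
  by rewrite mxtraceD mxtraceZ [\tr _]Hx [X in _ + X]Hy mulr0 addr0.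
- move=> x y [Dy Hy]; split; first exact: in_derived_br.
  by move=> z; rewrite killing_br.
Qed.

(* Cartan's argument: for an additive rational functional [f] on the eigenvalues
   [c] of [ad x], the derivation acting by [f c] on generalized eigenspaces is
   orthogonal to [ad x], so that the sum of the [c * f c] vanishes. *)
Lemma killing_radical_ad_nilp x : killing_radical x -> ad x ^+ d = 0.
Proof.
move=> Rx; pose L zs := [seq a + b | a <- zs, b <- zs] : seq F.
have [zs [rs [P [zsrs Lrs P0 HP]]]] := spectral_family_exists (ad x) (d + d)%N L.
have [Urs _ _ _ _] := HP.
apply: (spectral_nilpotent HP) => c crs cn0.
apply/eqP; rewrite -mxrank_eq0; apply: contraNT cn0 => rc; apply/eqP.
apply: (additive_functional_separation charF0 (n := fun c => \rank (P c)) Urs) crs rc.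
move=> f fadd; rewrite -(mxtrace_spectral_fun HP (fun c => ratr (f c))).
set D := spectral_fun _ _ _.
have DD : derivation br D.
  apply: (derivation_spectral_fun Lbr (derivation_ad Lbr _) HP _ zsrs P0) => // a b az bz.
  have abrs : a + b \in rs by apply: Lrs; apply/allpairsP; exists (a, b).
  by split=> //; rewrite (fadd _ _ (zsrs _ az) (zsrs _ bz) abrs) (ratrD_pchar0 charF0).
(* The radical is perfect, so [x] is a sum of brackets within it; by [mxtrace_ad_br] each one pairs
   with [D] as a value of the Killing form on the radical, which is 0. *)
have [l [Hl ->]] : in_derived br killing_radical x.
  by apply: ideal_perfect => //; [exact: ideal_killing_radical|move=> ? []].
rewrite (ad_mx_sum Lbr) mulmx_suml raddf_sum /= big1_seq // => p /andP[_ /Hl[p1 p2]].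
rewrite (mxtrace_ad_br Lbr) (ad_mx_derivation Lbr) //.
by case: p2 => _ H; apply: H.
Qed.

(** Engel's theorem kills all words of some length [N] on the radical; as the radical is perfect,
    [N] can be lowered step by step to 0. *)
Lemma killing_radical_eq0 x : killing_radical x -> x = 0.
Proof.
have idR := ideal_killing_radical; have [SR HR] := idR.
have nR a w : killing_radical a -> exists k, iter k (br a) w = 0.
  by move=> Ra; exists d; rewrite (iter_ad_mx Lbr) killing_radical_ad_nilp ?mulmx0.
have [||||N HN] := @engel _ _ _ Lbr killing_radical killing_radical _ SR.
- by split=> // a b _; apply: HR.
- by move=> a b _; apply: HR.
- by move=> a w Ra _; apply: nR.
- by move=> a w Ra _; apply: nR.
move=> Rx; elim: N HN => [|N IH] HN; first exact: (HN [::]).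
apply: IH => ys w sys Hys Rw.
have [|l [Hl ->]] := ideal_perfect idR _ Rw; first by move=> ? [].
rewrite (foldr_br_sum Lbr) big1_seq // => p /andP[_ /Hl[p1 p2]].
rewrite -[br _ _]/(foldr br p.2 [:: p.1]) -foldr_cat; apply: HN => //.
  by rewrite size_cat sys addn1.
by move=> z; rewrite mem_cat inE => /orP[/Hys|/eqP ->].
Qed.

(** The Gram matrix [G] of the form on a basis of the derived algebra is invertible: a kernel vector
    is orthogonal to the derived algebra and to the center, hence in the radical. *)
Lemma killing_representation (tau : 'rV[F]_d -> F) :
  (forall a x y, tau (a *: x + y) = a * tau x + tau y) ->
  exists2 m, derived m & forall y, derived y -> killing m y = tau y.
Proof.
move=> tauP; have tau0 : tau 0 = 0.
  by have := tauP (-1) 0 0; rewrite scaler0 addr0 mulN1r addNr.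
have tau_sum (I : finType) (c : I -> F) (f : I -> 'rV_d) :
    tau (\sum_i c i *: f i) = \sum_i c i * tau (f i).
  by elim/big_rec2: _ => [|i x y _ <-] //; rewrite tauP.
have [B0 HB0] := subspace_rowspace derivedS.
pose B := row_base B0.
have HB x : derived x <-> (x <= B)%MS by rewrite HB0 eq_row_base.
have DB i : derived (row i B) by apply/HB; apply: row_sub.
have killl n (v : 'rV_n) (A : 'M_(n, d)) y :
    killing (v *m A) y = \sum_i v 0 i * killing (row i A) y.
  rewrite /killing mulmx_sum_row (ad_mx_sum Lbr) mulmx_suml raddf_sum.
  by apply: eq_bigr => i _ /=; rewrite (ad_mxZ Lbr) -scalemxAl mxtraceZ.
have killC x y : killing x y = killing y x by rewrite /killing mxtrace_mulC.
pose G := \matrix_(i, j) killing (row i B) (row j B).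
have Gfree : row_free G.
  apply: inj_row_free => v vG.
  apply: (row_free_inj (row_base_free B0)); rewrite mul0mx.
  apply: killing_radical_eq0; split; first by apply/HB; apply: submxMl.
  move=> y; have [a [b [/HB/submxP[w ->] Zb ->]]] := derived_decomp y.
  have adb : ad b = 0 by apply: eq_row_mulmx => u; rewrite (mul_ad_mx Lbr) Zb mulmx0.
  rewrite killC /killing (ad_mxD Lbr) adb addr0 -/(killing _ _) killl big1 // => j _.
  rewrite killC killl.
  have := congr1 (fun A : 'rV_(\rank B0) => A 0 j) vG; rewrite !mxE => vGj.
  rewrite (eq_bigr (fun i => v 0 i * G i j)) ?vGj ?mulr0 // => i _.
  by rewrite mxE.
have Gu : G \in unitmx by rewrite -row_free_unit.
pose t : 'rV_(\rank B0) := \row_j tau (row j B).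
exists (t *m invmx G *m B); first by apply/HB; apply: submxMl.
move=> y /HB/submxP[w ->]; rewrite killC killl [w *m B]mulmx_sum_row tau_sum.
apply: eq_bigr => j _; congr (_ * _); rewrite killC killl.
have := congr1 (fun A : 'rV_(\rank B0) => A 0 j) (mulmxKV Gu t); rewrite !mxE => <-.
by apply: eq_bigr => i _; rewrite [G _ _]mxE.
Qed.

(** The nilpotent part [N] of [ad X] is a derivation. Representing its trace form by [m] in the
    derived algebra leaves a derivation [E = N - ad m] orthogonal to all [ad y], and nondegeneracy
    forces [E = 0]. *)
Lemma jordan_exists X : exists s m, jordan_in br total X s m.
Proof.
(* Sums make [S] a derivation; 0 is listed so that [S] kills the kernel of [ad X]. The successor in
   the exponent below keeps it at least 1 even if [d = 0]. *)
pose L zs := 0 :: [seq a + b | a <- zs, b <- zs] : seq F.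
have [zs [rs [P [zsrs Lrs P0 HP]]]] := spectral_family_exists (ad X) (d + d).+1 L.
have [Urs _ PM PE [PP PC _]] := HP.
pose S := spectral_fun rs P id; pose N := ad X - S.
have DN : derivation br N.
  apply: (derivationB Lbr); first exact: derivation_ad.
  apply: (derivation_spectral_fun Lbr (derivation_ad Lbr _) HP _ zsrs P0) => [|a b az bz].
    exact: leqnSn.
  by split=> //; apply: Lrs; rewrite in_cons; apply/orP; right; apply/allpairsP; exists (a, b).
have [|m Dm Hm] := @killing_representation (fun y => \tr (N *m ad y)).
  move=> a x y; rewrite (ad_mxD Lbr) (ad_mxZ Lbr) mulmxDr -scalemxAr.
  by rewrite mxtraceD mxtraceZ.
have S0 (u : 'rV_d) : u *m ad X = 0 -> u *m S = 0.
  move=> uX; rewrite -(scale0r u); apply: (spectral_fun_eigen HP).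
    by apply: Lrs; apply: mem_head.
  apply: (PE _ 1%N) => //; first by apply: Lrs; apply: mem_head.
  by rewrite expr1 raddf0 subr0.
pose E := N - ad m.
have DE : derivation br E by apply: (derivationB Lbr) => //; apply: derivation_ad.
have central_ad b : (forall y, br b y = 0) -> ad b = 0.
  by move=> Zb; apply: eq_row_mulmx => u; rewrite (mul_ad_mx Lbr) Zb mulmx0.
have trE y : \tr (E *m ad y) = 0.
  have [a [b [Da /central_ad Zb ->]]] := derived_decomp y.
  by rewrite (ad_mxD Lbr) Zb addr0 mulmxBl raddfB /= -(Hm a Da) subrr.
(* A derivation preserves the derived algebra, and [E] kills the center because [ad X], [S] and
   [ad m] do. *)
have DuE u : derived (u *m E).
  have [a [b [[l [_ ->]] Zb ->]]] := derived_decomp u.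
  rewrite mulmxDl; apply: (subspaceD derivedS).
    rewrite mulmx_suml; apply: (subspace_sum _ derivedS) => p _.
    by rewrite DE; apply: (subspaceD derivedS); apply: in_derived_br.
  have Zb' y : br y b = 0 by rewrite (brC Lbr) Zb oppr0.
  have bX : b *m ad X = 0 by rewrite (mul_ad_mx Lbr).
  have -> : b *m E = 0.
    by rewrite /E /N !mulmxBr S0 // bX (mul_ad_mx Lbr) Zb' !subrr.
  by case: derivedS.
(* [killing (u *m E) y] is the trace of [E *m ad (br u y)], which is 0, so [u *m E] is in the
   radical. *)
have E0 : N = ad m.
  apply/eqP; rewrite -subr_eq0 -/E; apply/eqP.
  move: E DE trE DuE => E DE trE DuE; apply: eq_row_mulmx => u; rewrite mulmx0.
  apply: killing_radical_eq0; split; first exact: DuE.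
  move=> y; rewrite /killing -(ad_mx_derivation Lbr) // mulmxBl raddfB /=.
  rewrite -[RHS](trE (br u y)) (ad_mx_br Lbr) mulmxBr raddfB /= !mulmxA.
  by rewrite -[ad u *m _ *m _]mulmxA [X in X - _]mxtrace_mulC.
have sE : ad (X - m) = S.
  apply: eq_row_mulmx => u; rewrite -[S](subKr (ad X)) -/N E0 mulmxBr.
  by rewrite !(mul_ad_mx Lbr) (brBl Lbr).
have XmB : br m X = 0.
  rewrite -(mul_ad_mx Lbr) -E0 mulmxBr (mul_ad_mx Lbr) (brxx Lbr) S0 ?subrr //.
  by rewrite (mul_ad_mx Lbr) (brxx Lbr).
exists (X - m), m; split=> //; first by rewrite subrK.
  by rewrite (brBl Lbr) (brxx Lbr) subr0 (brC Lbr) XmB oppr0.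
have Seig c (u : 'rV_d) : c \in rs -> u *m P c *m S = c *: (u *m P c).
  by move=> crs; apply: (spectral_fun_eigen HP) => //; apply: (spectral_proj_eigen HP).
split=> //.
  move=> u _; exists [seq (c, u *m P c) | c <- rs]; split.
    by move=> p /mapP[c crs ->] /=; split=> //; rewrite -(mul_ad_mx Lbr) sE Seig.
  by rewrite big_map -(spectral_decomp HP).
exists d => u _; rewrite (iter_ad_mx Lbr) -E0 [u](spectral_decomp HP).
rewrite mulmx_suml big1_seq // => c /andP[_ crs].
(* On the image of [P c], [S] is the scalar [c], so [N] acts there as [ad X - c]. *)
have Nk k (w : 'rV_d) : w *m P c = w -> w *m N ^+ k = w *m (ad X - c%:M) ^+ k.
  elim: k w => [|k IH] w wP; first by rewrite !expr0.
  rewrite !exprS -!mulmxE !mulmxA.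
  have -> : w *m N = w *m (ad X - c%:M).
    by rewrite -wP !mulmxBr Seig // mul_mx_scalar.
  apply: IH; rewrite -{2}wP -!mulmxA; congr (_ *m _).
  by apply: PC; rewrite mulmxBl mulmxBr scalar_mxC.
by rewrite Nk ?(spectral_proj_eigen HP) // -mulmxA PM mulmx0.
Qed.

End JordanExistence.

(** * Coordinates *)

Section Coordinates.
Variables (F : fieldType) (V : lmodType F) (br : V -> V -> V).
Hypothesis Lbr : is_lie_bracket br.

(** Identifies [A] with a Lie algebra of row vectors, where the matrix arguments apply. [cinv] is a
    total function whose values outside [A] are arbitrary. *)
Record coordinates (A : V -> Prop) := Coordinates {
  cdim : nat;
  cmap : 'rV[F]_cdim -> V;
  cinv : V -> 'rV[F]_cdim;
  cbr : 'rV[F]_cdim -> 'rV[F]_cdim -> 'rV[F]_cdim;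
  cmap_linear : forall a x y, cmap (a *: x + y) = a *: cmap x + cmap y;
  cmap_in : forall u, A (cmap u);
  cmapK : cancel cmap cinv;
  cinvK : forall x, A x -> cmap (cinv x) = x;
  cmap_br : forall u v, cmap (cbr u v) = br (cmap u) (cmap v);
  cbr_lie : is_lie_bracket cbr }.
Arguments cmap {A} c u.
Arguments cinv {A} c x.
Arguments cbr {A} c u v.
Arguments cmap_linear {A} c a x y.
Arguments cmap_in {A} c u.
Arguments cmapK {A} c.
Arguments cinvK {A} c [x].
Arguments cmap_br {A} c u v.

Lemma coordinates_exist A : subalgebra br A -> fin_dim A -> inhabited (coordinates A).
Proof.
move=> [SA AA] [n [b Hb]].
pose j (c : 'rV[F]_n) := \sum_i c 0 i *: b i.
have jl a x y : j (a *: x + y) = a *: j x + j y.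
  rewrite /j scaler_sumr -big_split; apply: eq_bigr => i _ /=.
  by rewrite !mxE scalerDl scalerA.
have j0 : j 0 = 0 by rewrite /j big1 // => i _; rewrite mxE scale0r.
(* The spanning family may be dependent: [U] collects its relations, and a complement of [U]
   supplies the coordinates. *)
have [U HU] : exists U : 'M[F]_n, forall x, j x = 0 <-> (x <= U)%MS.
  apply: (@subspace_rowspace _ _ (fun x => j x = 0)); split=> // a x y.
  by rewrite jl => -> ->; rewrite scaler0 addr0.
pose d := \rank (U^C)%MS; pose B : 'M_(d, n) := row_base (U^C)%MS.
pose I (u : 'rV[F]_d) := j (u *m B).
have Il a x y : I (a *: x + y) = a *: I x + I y.
  by rewrite /I mulmxDl -scalemxAl jl.
have I0 u : I u = 0 -> u = 0.
  move=> /HU uU; apply: (row_free_inj (row_base_free (U^C)%MS)); rewrite mul0mx.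
  apply/eqP; rewrite -submx0 -(capmx_compl U) sub_capmx uU.
  by rewrite -(eq_row_base (U^C)%MS) submxMl.
have Iin u : A (I u) by apply/Hb; exists (fun i => (u *m B) 0 i).
have Isurj x : A x -> exists u, I u = x.
  move=> /Hb[c ->]; pose v : 'rV[F]_n := \row_i c i.
  have vE : \sum_i c i *: b i = j v by apply: eq_bigr => i _; rewrite mxE.
  have : (v <= U + U^C)%MS by rewrite submx_full ?addsmx_compl_full.
  rewrite vE => /sub_addsmxP[[w w'] /= ->].
  have /submxP[u uE] : (w' *m U^C <= B)%MS by rewrite eq_row_base submxMl.
  exists u; rewrite /I -uE -[w *m U]scale1r jl scale1r.
  by have /HU -> : (w *m U <= U)%MS; [exact: submxMl|rewrite add0r].
have /choice[J HJ] : forall x, exists u, A x -> I u = x.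
  move=> x; have [/Isurj[u <-]|nAx] := pselect (A x); first by exists u.
  by exists 0.
have Iinj u v : I u = I v -> u = v.
  move=> uv; apply/eqP; rewrite -subr_eq0; apply/eqP/I0.
  by rewrite addrC -scaleN1r Il uv scaleN1r addNr.
have IJ u : J (I u) = u by apply/Iinj/HJ/Iin.
pose br' u v := J (br (I u) (I v)).
have Ibr u v : I (br' u v) = br (I u) (I v) by apply/HJ/AA; apply: Iin.
have ID x y : I (x + y) = I x + I y by rewrite -{1}[x]scale1r Il scale1r.
have I00 : I 0 = 0 by rewrite /I mul0mx.
have [L1 [L2 [L3 L4]]] := Lbr.
have Lbr' : is_lie_bracket br'.
  split=> [a x y z|]; first by apply: Iinj; rewrite Ibr !Il L1 !Ibr.
  split=> [a x y z|]; first by apply: Iinj; rewrite Ibr !Il L2 !Ibr.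
  split=> [x|x y z]; apply: Iinj; first by rewrite Ibr L3 I00.
  by rewrite !ID !Ibr L4 I00.
exact: (inhabits (Coordinates Il Iin IJ HJ Ibr Lbr')).
Qed.

Section Transport.
Variables (A : V -> Prop) (co : coordinates A).
Local Notation phi := (cmap co).
Local Notation psi := (cinv co).
Local Notation br' := (cbr co).
Local Notation total := (fun _ : 'rV[F]_(cdim co) => True).

Lemma cmap0 : phi 0 = 0.
Proof. by have := cmap_linear co (-1) 0 0; rewrite scaler0 addr0 scaleN1r addNr. Qed.

Lemma cmapD x y : phi (x + y) = phi x + phi y.
Proof. by rewrite -{1}[x]scale1r cmap_linear scale1r. Qed.

Lemma cmapZ a x : phi (a *: x) = a *: phi x.
Proof. by rewrite -[a *: x]addr0 cmap_linear cmap0 addr0. Qed.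

Lemma cmap_sum (I : Type) (r : seq I) (f : I -> 'rV_(cdim co)) :
  phi (\sum_(i <- r) f i) = \sum_(i <- r) phi (f i).
Proof. by elim/big_rec2: _ => [|i x y _ <-]; [exact: cmap0|rewrite cmapD]. Qed.

Lemma cmap_inj : injective phi.
Proof. exact: can_inj (cmapK co). Qed.

Lemma cmap_iter k x y : phi (iter k (br' x) y) = iter k (br (phi x)) (phi y).
Proof. by elim: k => //= k <-; rewrite cmap_br. Qed.

Lemma cmap_foldr ys w : phi (foldr br' w ys) = foldr br (phi w) (map phi ys).
Proof. by elim: ys => //= y ys <-; rewrite cmap_br. Qed.

Lemma subspace_coord B : subspace B -> subspace (B \o phi).
Proof.
move=> [B0 HB]; split=> /=; first by rewrite cmap0.
by move=> a x y Bx By; rewrite cmap_linear; apply: HB.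
Qed.

Lemma subalgebra_coord B : subalgebra br B -> subalgebra br' (B \o phi).
Proof.
move=> [SB BB]; split; first exact: subspace_coord.
by move=> x y Bx By /=; rewrite cmap_br; apply: BB.
Qed.

Lemma reductive_in_coord B : psubset B A -> reductive_in br B A ->
  reductive_in br' (B \o phi) total.
Proof.
move=> BA red W SW _ BW; pose W1 x := exists2 u, W u & x = phi u.
have [W2 [SW2 W2A BW2 W12 W1D2]] : exists W2, [/\ subspace W2, psubset W2 A,
    ad_invariant br B W2, (forall x, W1 x -> W2 x -> x = 0) &
    (forall x, A x -> exists y z, [/\ W1 y, W2 z & x = y + z])].
  apply: red.
  - split; first by exists 0; [case: SW|rewrite cmap0].
    move=> a _ _ [u Wu ->] [v Wv ->]; exists (a *: u + v); last by rewrite cmap_linear.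
    by apply: SW.2.
  - by move=> _ [u _ ->]; apply: cmap_in.
  - move=> x _ Bx [u Wu ->]; exists (br' (psi x) u).
      by apply: BW => //=; rewrite cinvK //; apply: BA.
    by rewrite cmap_br cinvK //; apply: BA.
exists (W2 \o phi); split=> //; first exact: subspace_coord.
- by move=> x y Bx W2y /=; rewrite cmap_br; apply: BW2.
- by move=> x Wx W2x; apply: cmap_inj; rewrite cmap0; apply: W12 => //; exists x.
- move=> x _; have [_ [z [[u Wu ->] W2z xE]]] := W1D2 _ (cmap_in co x).
  exists u, (psi z); split=> //=; first by rewrite cinvK //; apply: W2A.
  by apply: cmap_inj; rewrite cmapD cinvK //; apply: W2A.
Qed.

Lemma jordan_in_coord B X s m : psubset B A ->
  jordan_in br' (B \o phi) X s m <-> jordan_in br B (phi X) (phi s) (phi m).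
Proof.
move=> BA; have BK x : B x -> phi (psi x) = x by move=> /BA; apply: cinvK.
split=> -[Bs Bm XE sm [sB [k mB] [l [Hl mE]]]].
  split=> //; first by rewrite XE cmapD.
    by rewrite -cmap_br sm cmap0.
  split.
  - move=> y By; have [|ly [Hly yE]] := sB (psi y); first by rewrite /= BK.
    exists [seq (p.1, phi p.2) | p <- ly]; split.
      move=> _ /mapP[p /Hly[p1 p2] ->]; split=> //=.
      by rewrite -cmap_br p2 cmapZ.
    by rewrite -[LHS]BK // yE cmap_sum big_map.
  - exists k => y By; rewrite -[y]BK // -cmap_iter mB ?cmap0 //.
    by rewrite /= BK.
  - exists [seq (phi p.1, phi p.2) | p <- l]; split.
      by move=> _ /mapP[p /Hl[p1 p2] ->].
    by rewrite mE cmap_sum big_map; apply: eq_bigr => p _; rewrite cmap_br.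
split=> //; first by apply: cmap_inj; rewrite XE cmapD.
  by apply: cmap_inj; rewrite cmap_br sm cmap0.
split.
- move=> y By; have [ly [Hly yE]] := sB _ By.
  exists [seq (p.1, psi p.2) | p <- ly]; split.
    move=> _ /mapP[p /Hly[p1 p2] ->] /=; rewrite BK //; split=> //.
    by apply: cmap_inj; rewrite cmap_br BK // p2 cmapZ BK.
  apply: cmap_inj; rewrite yE cmap_sum big_map; apply: eq_big_seq => p /Hly[p1 _].
  by rewrite BK.
- by exists k => y By; apply: cmap_inj; rewrite cmap_iter mB // cmap0.
- exists [seq (psi p.1, psi p.2) | p <- l]; split.
    by move=> _ /mapP[p /Hl[p1 p2] ->] /=; rewrite !BK.
  apply: cmap_inj; rewrite mE cmap_sum big_map; apply: eq_big_seq => p /Hl[p1 p2].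
  by rewrite cmap_br !BK.
Qed.

Lemma fin_dim_subspace B : subspace B -> psubset B A -> fin_dim B.
Proof.
move=> SB BA; have [M HM] := subspace_rowspace (subspace_coord SB).
exists (cdim co), (fun i => phi (row i M)) => x; split=> [Bx|[c ->]].
  have /HM/submxP[v vE] : (B \o phi) (psi x) by rewrite /= cinvK //; apply: BA.
  exists (fun i => v 0 i); rewrite -[x](cinvK co); last exact: BA.
  by rewrite vE mulmx_sum_row cmap_sum; apply: eq_bigr => i _; rewrite cmapZ.
apply: (subspace_sum _ SB) => i _; apply: (subspaceZ _ SB).
by apply/(HM (row i M)); apply: row_sub.
Qed.

Lemma engel_coord B W : subalgebra br B -> psubset B W -> subspace W -> psubset W A ->
  ad_invariant br B W -> (forall b w, B b -> W w -> exists k, iter k (br b) w = 0) ->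
  exists N, forall ys w, size ys = N -> (forall y, y \in ys -> B y) -> W w ->
    foldr br w ys = 0.
Proof.
move=> SB BW SW WA HB nil.
have nil' b w : B (phi b) -> W (phi w) -> exists k, iter k (br' b) w = 0.
  move=> Bb Ww; have [k Hk] := nil _ _ Bb Ww.
  by exists k; apply: cmap_inj; rewrite cmap_iter Hk cmap0.
have [|||N HN] := engel (cbr_lie co) (subalgebra_coord SB) (subspace_coord SW).
- by move=> x y Bx Wy /=; rewrite cmap_br; apply: HB.
- by move=> x y Bx By; apply: nil' => //; apply: BW.
- by move=> x y; apply: nil'.
exists N => ys w sys Hys Ww.
have phiK z : W z -> phi (psi z) = z by move=> /WA; apply: cinvK.
have -> : ys = map phi (map psi ys).
  rewrite -map_comp -[LHS]map_id; apply/eq_in_map => z /Hys Bz /=.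
  by rewrite phiK //; apply: BW.
rewrite -[w]phiK // -cmap_foldr HN ?cmap0 ?size_map //=; last by rewrite phiK.
by move=> _ /mapP[z /Hys Bz ->]; rewrite phiK //; apply: BW.
Qed.

End Transport.
End Coordinates.
Arguments cmap {F V br A} c u.
Arguments cinv {F V br A} c x.
Arguments cbr {F V br A} c u v.
Arguments cmap_in {F V br A} c u.
Arguments cinvK {F V br A} c [x].
Arguments cbr_lie {F V br A} c.
Arguments reductive_in_coord {F V br A} co [B].
Arguments jordan_in_coord {F V br A} co [B X s m].
Arguments subspace_coord {F V br A} co [B].

(** * Locally reductive Lie algebras *)

Section LocallyReductive.
Variables (F : closedFieldType) (charF0 : [pchar F] =i pred0).
Variables (V : lmodType F) (br : V -> V -> V) (gs : nat -> V -> Prop).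
Hypotheses (Lbr : is_lie_bracket br) (LR : locally_reductive br gs).

Lemma br_linear x : linear_map (br x).
Proof. by move=> a y z; rewrite (brDr Lbr) (brZr Lbr). Qed.

Lemma gs_subalgebra n : subalgebra br (gs n).
Proof. by have [/(_ n)[]] := LR. Qed.

Lemma gs_subspace n : subspace (gs n).
Proof. by case: (gs_subalgebra n). Qed.

Lemma gs_mono n p : (n <= p)%N -> psubset (gs n) (gs p).
Proof.
move=> /subnK <-; elim: (p - n)%N => [|k IH] x //= /IH.
by have [/(_ (k + n)%N)[_ _ _ H _] _] := LR; apply: H.
Qed.

Lemma gs_seq (l : seq V) : exists n, forall x, x \in l -> gs n x.
Proof.
elim: l => [|y l [n Hn]]; first by exists 0%N.
have [p Hp] := LR.2 y; exists (maxn n p) => x; rewrite in_cons => /orP[/eqP ->|/Hn].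
  exact: gs_mono (leq_maxr _ _) _ Hp.
exact: gs_mono (leq_maxl _ _) _.
Qed.

Lemma gs_coordinates n : inhabited (coordinates br (gs n)).
Proof.
have [/(_ n)[SA FA _ _ _] _] := LR; exact: coordinates_exist.
Qed.

Lemma gs_fin_dim A n : subspace A -> psubset A (gs n) -> fin_dim A.
Proof. by move=> SA AG; have [co] := gs_coordinates n; apply: (fin_dim_subspace co). Qed.

Lemma fin_dim_gs A : fin_dim A -> exists n, psubset A (gs n).
Proof.
move=> [k [b Hb]]; have [n Hn] := gs_seq (codom b).
exists n => x /Hb[c ->]; apply: (subspace_sum _ (gs_subspace n)) => i _.
by apply: (subspaceZ _ (gs_subspace n)); apply: Hn; apply: codom_f.
Qed.

Lemma jordan_in_gs n X : gs n X -> exists s m, jordan_in br (gs n) X s m.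
Proof.
move=> nX; have [co] := gs_coordinates n.
have [/(_ n)[_ _ red _ _] _] := LR.
have red' : reductive_in (cbr co) (fun=> True) (fun=> True).
  have := reductive_in_coord co (fun _ H => H) red.
  by rewrite (_ : gs n \o cmap co = fun=> True) //; apply/funext => u;
    apply/propext; split=> // _; apply: cmap_in.
have [s [m Hsm]] := jordan_exists charF0 (cbr_lie co) red' (cinv co X).
exists (cmap co s), (cmap co m); rewrite -[X](cinvK co) //.
apply/(jordan_in_coord _ (fun _ H => H)).
by rewrite (_ : gs n \o cmap co = fun=> True) //; apply/funext => u;
  apply/propext; split=> // _; apply: cmap_in.
Qed.

Lemma jordan_in_gsS n X s m : jordan_in br (gs n) X s m -> jordan_in br (gs n.+1) X s m.
Proof.
move=> J; have [co] := gs_coordinates n.+1.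
have [/(_ n)[_ _ _ sub red] _] := LR.
have K x : gs n x -> cmap co (cinv co x) = x by move=> /sub; apply: cinvK.
have nX : gs n X.
  by have [ns nm -> _ _] := J; apply: (subspaceD (gs_subspace n)).
have [ns nm _ _ _] := J.
have : jordan_in (cbr co) (gs n \o cmap co) (cinv co X) (cinv co s) (cinv co m).
  by apply/(jordan_in_coord co sub); rewrite !K.
move/(jordan_in_total charF0 (cbr_lie co) (reductive_in_coord co sub red)
  (subspace_coord co (gs_subspace n))).
have -> : (fun=> True) = gs n.+1 \o cmap co.
  by apply/funext => u; apply/propext; split=> // _; apply: cmap_in.
by move/(jordan_in_coord co (fun _ H => H)); rewrite !K.
Qed.

Lemma jordan_in_gs_mono n p X s m : (n <= p)%N ->
  jordan_in br (gs n) X s m -> jordan_in br (gs p) X s m.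
Proof.
by move=> /subnK <- J; elim: (p - n)%N => //= k IH; apply: jordan_in_gsS.
Qed.

Lemma jordanD_exists X : exists s m, jordanD br gs X s m.
Proof.
have [n nX] := LR.2 X; have [s [m J]] := jordan_in_gs nX.
by exists s, m, n.
Qed.

(** Persistence lets the level be raised until it contains any given vector. *)
Lemma jordanD_at X s m p : jordanD br gs X s m ->
  exists2 n, (p <= n)%N & jordan_in br (gs n) X s m.
Proof.
move=> [n [_ J]]; exists (maxn n p); first exact: leq_maxr.
exact: jordan_in_gs_mono (leq_maxl _ _) J.
Qed.

Lemma jordanD_nil X s m y : jordanD br gs X s m -> exists k, iter k (br m) y = 0.
Proof.
move=> J; have [p py] := LR.2 y.
have [n pn [_ _ _ _ [_ [k Hk] _]]] := jordanD_at p J.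
by exists k; apply: Hk; apply: gs_mono pn _ py.
Qed.

Lemma semisimple_eltP x :
  semisimple_elt br gs x <-> exists2 n, gs n x & ad_diag_on br (gs n) x.
Proof.
split=> [[n [nx [_ _ _ _ [sx _ _]]]]|[n nx sx]]; first by exists n.
exists n; split=> //; split=> //.
- by case: (gs_subspace n).
- by rewrite addr0.
- exact: br0r.
- split=> //; first by exists 1%N => y _ /=; apply: br0l.
  by exists [::]; rewrite big_nil.
Qed.

Lemma semisimple_part X s m : jordanD br gs X s m -> semisimple_elt br gs s.
Proof.
by move=> [n [_ [ns _ _ _ [sA _ _]]]]; apply/semisimple_eltP; exists n.
Qed.

Lemma ad_diag_ker A s y k : ad_diag_on br A s -> A y ->
  iter k (br s) y = 0 -> br s y = 0.
Proof.
move=> sA /sA[l [Hl ->]]; apply: eigen_sum_ker; first exact: br_linear.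
by move=> p /Hl[].
Qed.

(** [ad s = ad X - ad m] is a difference of commuting maps, both nilpotent at [u], hence is
    nilpotent at [u]; being diagonalizable, it kills [u]. With [k = 1], whatever commutes with [X]
    commutes with [s]. *)
Lemma semisimple_part_ker X s m u k : jordanD br gs X s m ->
  iter k (br X) u = 0 -> br s u = 0.
Proof.
move=> J Hk; have [p pu] := LR.2 u.
have [n pn [ns nm XE sm [sA [j Hj] _]]] := jordanD_at p J.
have nu : gs n u by apply: gs_mono pn _ pu.
apply: (@ad_diag_ker _ _ _ (k + j) sA nu).
have -> : br s = fun y => br X y - br m y.
  by apply/funext => y; rewrite XE (brDl Lbr) addrK.
apply: iter_commuting_sub => //; try exact: br_linear; last exact: Hj.
move=> y; rewrite (br_jacobi Lbr X) XE (brDl Lbr s m m) sm (brxx Lbr) addr0.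
by rewrite (br0l Lbr) add0r.
Qed.

Lemma semisimple_ker x y k : semisimple_elt br gs x -> iter k (br x) y = 0 -> br x y = 0.
Proof. exact: semisimple_part_ker. Qed.

Lemma semisimple_eventually x : semisimple_elt br gs x ->
  exists n, forall p, (n <= p)%N -> gs p x /\ ad_diag_on br (gs p) x.
Proof.
move=> [n [_ J]]; exists n => p np.
by have [px _ _ _ [xp _ _]] := jordan_in_gs_mono np J.
Qed.

(** Simultaneous diagonalization: an eigenspace of [ad x] is stable under [ad y], so
    [eigen_sum_invariant] splits its vectors into eigenvectors of [ad y] inside it. *)
Lemma semisimple_comm_add a x y : semisimple_elt br gs x -> semisimple_elt br gs y ->
  br x y = 0 -> semisimple_elt br gs (a *: x + y).
Proof.
move=> /semisimple_eventually[n Hn] /semisimple_eventually[p Hp] xy.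
have [gx xg] := Hn _ (leq_maxl n p); have [gy yg] := Hp _ (leq_maxr n p).
move: (maxn n p) gx xg gy yg => q gx xg gy yg {n Hn p Hp}.
have SG := gs_subspace q.
apply/semisimple_eltP; exists q; first exact: SG.2.
move=> u gu; have [l [Hl ->]] := xg u gu.
rewrite big_seq; apply: (subspace_sum _ (subspace_eigen_sum (br_linear _) SG)) => r.
move=> /Hl[gr xr]; have [l1 [Hl1 rE]] := yg _ gr.
pose W v := gs q v /\ br x v = r.1 *: v.
have SW : subspace W.
  split; first by split; [case: SG|rewrite (br0r Lbr) scaler0].
  move=> c v w [gv xv] [gw xw]; split; first exact: SG.2.
  by rewrite (brDr Lbr) (brZr Lbr) xv xw scalerDr !scalerA mulrC.
have [|||l2 [Hl2 Wl2 l2E]] := @eigen_sum_invariant _ _ (br y) W l1 (br_linear y) SW.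
- move=> v [gv xv]; split; first exact: (gs_subalgebra q).2.
  by rewrite (br_jacobi Lbr) xy (br0l Lbr) add0r xv (brZr Lbr).
- by move=> v /Hl1[].
- by rewrite -rE.
exists [seq (a * r.1 + v.1, v.2) | v <- l2]; split; last by rewrite rE l2E big_map.
move=> _ /mapP[v vl2 ->] /=; have [gv xv] := Wl2 _ vl2; split=> //.
by rewrite (brDl Lbr) (brZl Lbr) xv (Hl2 _ vl2) scalerA scalerDl.
Qed.

(** If [[x, z] = c z] with [z] in [T], then the square of [ad z] kills [x], so [ad z] does and
    [c z = 0]. For general [y], induction on the number of eigenvectors of [ad x] in its expansion
    shows that [[x, y]] satisfies such an equation. *)
Lemma toral_abelian T x y : toral br gs T -> T x -> T y -> br x y = 0.
Proof.
move=> [[ST TT] HT] Tx Ty.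
have eig c z : T z -> c != 0 -> br x z = c *: z -> z = 0.
  move=> Tz cn0 xz; have zx : br z x = - c *: z by rewrite (brC Lbr) xz scaleNr.
  have : br z x = 0.
    apply: (@semisimple_ker _ _ 2 (HT _ Tz)).
    by rewrite /= zx (brZr Lbr) (brxx Lbr) scaler0.
  by rewrite zx => /eqP; rewrite scaler_eq0 oppr_eq0 (negPf cn0) => /eqP.
have [p py] := LR.2 y; have [n Hn] := semisimple_eventually (HT _ Tx).
have [_ xg] := Hn _ (leq_maxl n p).
have [l [Hl yE]] := xg _ (gs_mono (leq_maxr n p) py).
have {}Hl : eigen_list (br x) l by move=> q /Hl[].
have [k] := ubnP (size l); elim: k l y Ty Hl yE {py} => // k IH [|q l] y Ty Hl yE sl.
  by rewrite yE big_nil (br0r Lbr).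
have [Hz Ez] := eigen_list_shift q.1 (br_linear x) Hl.
have : br x (br x y - q.1 *: y) = 0.
  move: Hz Ez => /=; set l' := [seq _ | _ <- l] => Hz Ez.
  apply: (IH l').
  - by apply: (subspaceB ST); [apply: TT|apply: (subspaceZ _ ST)].
  - by move=> r rl; apply: Hz; rewrite in_cons rl orbT.
  - by rewrite yE Ez big_cons subrr scale0r add0r.
  - by rewrite size_map.
rewrite (brBr Lbr) (brZr Lbr) => /eqP; rewrite subr_eq0 => /eqP xxy.
have [q0|qn0] := eqVneq q.1 0.
  by apply: (@semisimple_ker _ _ 2 (HT _ Tx)); rewrite /= xxy q0 scale0r.
by apply: (eig q.1) => //; apply: TT.
Qed.

(* The semisimple parts act by zero on [C], so that each element of [A] acts on
   [C] as its nilpotent part. *)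
Lemma centralized_engel C A n : subalgebra br C -> subalgebra br A -> psubset A C ->
  psubset A (gs n) ->
  (forall X s m, A X -> jordanD br gs X s m -> forall w, C w -> br s w = 0) ->
  exists N, forall ys w, size ys = N -> (forall y, y \in ys -> A y) ->
    C w -> gs n w -> foldr br w ys = 0.
Proof.
move=> [SC CC] SA AC An HC; have [co] := gs_coordinates n.
have [SG GG] := gs_subalgebra n.
have [||||||N HN] := @engel_coord _ _ _ _ co A (fun x => C x /\ gs n x).
- exact: SA.
- by move=> x Ax; split; [apply: AC|apply: An].
- split; first by split; [case: SC|case: SG].
  by move=> a x y [Cx nx] [Cy ny]; split; [apply: SC.2|apply: SG.2].
- by move=> x [].
- by move=> x y Ax [Cy ny]; split; [apply: CC => //; apply: AC|apply: GG => //; apply: An].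
- move=> X w AX [Cw _]; have [s [m J]] := jordanD_exists X.
  have [k Hk] := jordanD_nil w J; exists k; rewrite -Hk.
  have XE : X = s + m by have [p [_ [_ _ ->]]] := J.
  suff : C (iter k (br X) w) /\ iter k (br X) w = iter k (br m) w by case.
  elim: {Hk}k => [|k [Ck Ek]] //=; split; first by apply: CC => //; apply: AC.
  by rewrite -Ek {1}XE (brDl Lbr) (HC _ _ _ AX J) // add0r.
by exists N => ys w sys Hys Cw nw; apply: HN.
Qed.

(** * The three conditions on a subalgebra of a splittable subalgebra *)

Section CartanSubalgebra.
Variables K H : V -> Prop.
Hypotheses (SK : subalgebra br K) (splitK : splittable br gs K).
Hypotheses (SH : subalgebra br H) (HK : psubset H K).
Let ss := ss_part br gs H.

Lemma line_subalgebra x : H x ->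
  let L := fun y => exists a : F, y = a *: x in
  [/\ subalgebra br L, fin_dim L & psubset L H].
Proof.
move=> Hx; split.
- split; first split; first by exists 0; rewrite scale0r.
    by move=> a _ _ [b ->] [c ->]; exists (a * b + c); rewrite scalerDl scalerA.
  move=> _ _ [b ->] [c ->]; exists 0.
  by rewrite (brZl Lbr) (brZr Lbr) (brxx Lbr) !scaler0 scale0r.
- exists 1%N, (fun=> x) => y; split=> [[a ->]|[c ->]].
    by exists (fun=> a); rewrite big_ord1.
  by exists (c ord0); rewrite big_ord1.
- by move=> _ [a ->]; apply: (subspaceZ _ SH.1).
Qed.

(** The defining condition is tested on the line spanned by [y]. *)
Lemma k0bar_iter x y : k0bar br K H x -> H y -> exists k, iter k (br y) x = 0.
Proof.
move=> [_ Hx] Hy; have [SL FL LH] := line_subalgebra Hy.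
have [n Hn] := Hx _ SL FL LH; exists n.
rewrite -[n](size_nseq n y) -(foldr_iter br); last first.
  by move=> z /nseqP[].
apply: Hn; first by rewrite size_nseq.
by move=> z /nseqP[-> _]; exists 1; rewrite scale1r.
Qed.

(** * Consequences of condition (1) *)

Section SelfCentralizing.
Hypothesis HE : pset_eq H (centralizer br K ss).

Lemma ss_part_central s y : ss s -> H y -> br s y = 0.
Proof. by move=> Hs /HE[_ Hy]; rewrite (brC Lbr) Hy ?oppr0. Qed.

(** An element of [H] commutes with every element of [ss], hence so does its semisimple part, which
    lies in [K]. *)
Lemma centralizer_splittable : splittable br gs H.
Proof.
move=> X s m HX J; have [Ks Km] := splitK (HK HX) J.
have Hs : H s.
  apply/HE; split=> // s' Hs'; apply: (semisimple_part_ker (k := 1) J) => /=.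
  by rewrite (brC Lbr) (ss_part_central Hs') ?oppr0.
split=> //; have [p [_ [_ _ XE _ _]]] := J.
have -> : m = X - s by rewrite XE addrC addKr.
exact: (subspaceB SH.1).
Qed.

Lemma ss_partS : psubset ss H.
Proof. by move=> s [X [m [HX /(centralizer_splittable HX)[]]]]. Qed.

Lemma ss_partP s : ss s <-> H s /\ semisimple_elt br gs s.
Proof.
split=> [Hs|[Hs Ss]]; last by exists s, 0.
split; first exact: ss_partS.
by have [X [m [_ J]]] := Hs; apply: semisimple_part J.
Qed.

(** Sums stay semisimple because [ss] is central in [H]. A toral subalgebra containing [ss] is
    abelian, so it centralizes [ss] and lies in [H]. *)
Lemma ss_part_max_toral : max_toral br gs K ss.
Proof.
have torss : toral br gs ss.
  split; last by move=> x /ss_partP[].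
  split; first split.
  - apply/ss_partP; split; first by case: SH => -[].
    apply/semisimple_eltP; exists 0%N; first by case: (gs_subspace 0).
    move=> y ny; exists [:: (0, y)]; rewrite big_seq1; split=> // p.
    by rewrite inE => /eqP ->; rewrite (br0l Lbr) scale0r.
  - move=> a x y /[dup] ssx /ss_partP[Hx Sx] /ss_partP[Hy Sy]; apply/ss_partP.
    split; first by apply: SH.1.2.
    by apply: semisimple_comm_add => //; apply: ss_part_central.
  - move=> x y ssx /ss_partS Hy; rewrite (ss_part_central ssx Hy).
    apply/ss_partP; split; first by case: SH => -[].
    apply/semisimple_eltP; exists 0%N; first by case: (gs_subspace 0).
    move=> z nz; exists [:: (0, z)]; rewrite big_seq1; split=> // p.
    by rewrite inE => /eqP ->; rewrite (br0l Lbr) scale0r.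
split=> //; first by move=> x /ss_partS /HK.
move=> T torT TK ssT x Tx; apply/ss_partP; split; last exact: torT.2.
apply/HE; split; first exact: TK.
by move=> y /ssT Ty; apply: toral_abelian torT _ _.
Qed.

Lemma centralizer_engel A n : subalgebra br A -> psubset A H -> psubset A (gs n) ->
  exists N, forall ys w, size ys = N -> (forall y, y \in ys -> A y) ->
    H w -> gs n w -> foldr br w ys = 0.
Proof.
move=> SA AH An; apply: centralized_engel => // X s m AX J w Hw.
by apply: ss_part_central => //; exists X, m; split=> //; apply: AH.
Qed.

Lemma centralizer_loc_nilpotent : loc_nilpotent br H.
Proof.
move=> l Hl; have [n Hn] := gs_seq l.
(* A finite set lies in some [gs n], and cutting [H] by that level gives a finite-dimensional
   subalgebra to which Engel's theorem applies. *)
pose A x := H x /\ gs n x.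
have SA : subalgebra br A.
  have [SG GG] := gs_subalgebra n; have [SH0 HH] := SH.
  split; first split; first by split; [case: SH0|case: SG].
    by move=> a x y [Hx nx] [Hy ny]; split; [apply: SH0.2|apply: SG.2].
  by move=> x y [Hx nx] [Hy ny]; split; [apply: HH|apply: GG].
exists A; split=> //.
- by apply: (@gs_fin_dim _ n SA.1) => x [].
- have [||N HN] := @centralizer_engel A n SA; try by move=> x [].
  by exists N => ys x sys Hys [Hx nx]; apply: HN.
- by move=> x [].
- by move=> x xl; split; [apply: Hl|apply: Hn].
Qed.

(** One inclusion is Engel's theorem. For the other, a semisimple element of [H] acting nilpotently
    on [x] commutes with [x]. *)
Lemma centralizer_k0bar : pset_eq H (k0bar br K H).
Proof.
move=> x; split=> [Hx|kx].
  split; first exact: HK.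
  move=> A SA FA AH; have [n An] := fin_dim_gs FA.
  have [p px] := LR.2 x.
  have [|N HN] := @centralizer_engel A (maxn n p) SA AH.
    by move=> y /An; apply: gs_mono (leq_maxl _ _) _.
  exists N => ys sys Hys; apply: HN => //.
  exact: gs_mono (leq_maxr _ _) _ px.
apply/HE; split; first by case: kx.
move=> s /ss_partP[Hs Ss]; have [k Hk] := k0bar_iter kx Hs.
by rewrite (brC Lbr) (semisimple_ker Ss Hk) oppr0.
Qed.

(** If [x] normalizes [H] and [s] is in [ss], then [[s, x]] is in [H], where [s] is central. So the
    square of [ad s] kills [x], and semisimplicity gives [[s, x] = 0]. *)
Lemma centralizer_self_normalizing : self_normalizing br K H.
Proof.
move=> x; split=> [Hx|[Kx Nx]].
  by split=> [|y Hy]; [apply: HK|apply: SH.2].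
apply/HE; split=> // s /[dup] sss /ss_partP[Hs Ss].
rewrite (brC Lbr) (semisimple_ker (k := 2) Ss) ?oppr0 //=.
by rewrite (brC Lbr s x) (brNr Lbr) (ss_part_central sss) ?oppr0 //; apply: Nx.
Qed.

End SelfCentralizing.

(** [T] is abelian, so it lies in [H] and in [ss]. Conversely the semisimple part [s] of an element
    of [H] commutes with [T]; [T] and [s] span a toral subalgebra of [K], and maximality puts [s] in
    [T]. *)
Lemma centralizer_max_toral T : max_toral br gs K T -> pset_eq H (centralizer br K T) ->
  pset_eq H (centralizer br K ss).
Proof.
move=> [torT TK Tmax] HT.
suff ssE s : ss s <-> T s.
  move=> x; rewrite HT; split=> -[Kx Hx]; split=> // y /ssE; exact: Hx.
have [[ST TT] Tss] := torT.
have TH t : T t -> H t.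
  by move=> Tt; apply/HT; split=> [|y Ty]; [apply: TK|apply: toral_abelian torT _ _].
split=> [[X [m [HX J]]]|Ts]; last by exists s, 0; split; [apply: TH|apply: Tss].
have [Ks _] := splitK (HK HX) J.
have Ss := semisimple_part J.
have sT t : T t -> br s t = 0.
  move=> Tt; apply: (semisimple_part_ker (k := 1) J) => /=.
  by move/HT: HX => [_]; apply.
pose T' x := exists a t, T t /\ x = a *: s + t.
have T'T' x y : T' x -> T' y -> br x y = 0.
  move=> [a [t [Tt ->]]] [b [u [Tu ->]]].
  rewrite (brDl Lbr) !(brDr Lbr) !(brZl Lbr) !(brZr Lbr) (brxx Lbr) (sT u) //.
  by rewrite (brC Lbr t s) (sT t) // (toral_abelian torT Tt Tu) oppr0 !scaler0 !addr0.
have T'0 : T' 0 by exists 0, 0; rewrite scale0r addr0; split=> //; case: ST.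
apply: (Tmax T'); last first.
- by exists 1, 0; rewrite scale1r addr0; split=> //; case: ST.
- by move=> t Tt; exists 0, t; rewrite scale0r add0r.
- move=> _ [a [t [Tt ->]]]; apply: SK.1.2 => //; exact: TK.
split; first split; first split=> //.
- move=> a _ _ [b [t [Tt ->]]] [c [u [Tu ->]]].
  exists (a * b + c), (a *: t + u); split; first exact: ST.2.
  by rewrite scalerDr scalerDl scalerA addrACA.
- by move=> x y /T'T' H1 /H1 ->.
- move=> _ [a [t [Tt ->]]]; apply: semisimple_comm_add => //; first exact: Tss.
  exact: sT.
Qed.

(** Elements of [H] act nilpotently on each vector of [H], so [ss] is central in [H]. On the
    centralizer of [ss] they act through their nilpotent parts, and Engel's theorem puts that
    centralizer in [k0bar br K H]. *)
Lemma k0bar_centralizer : pset_eq H (k0bar br K H) -> pset_eq H (centralizer br K ss).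
Proof.
move=> Hk.
have ssH s y : ss s -> H y -> br s y = 0.
  move=> [X [m [HX J]]] /Hk ky; have [k Hk'] := k0bar_iter ky HX.
  exact: semisimple_part_ker J Hk'.
move=> x; split=> [Hx|Zx].
  by split=> [|s Hs]; [apply: HK|rewrite (brC Lbr) ssH ?oppr0].
apply/Hk; split; first by case: Zx.
move=> A SA FA AH; have [n An] := fin_dim_gs FA; have [p px] := LR.2 x.
have [|||||N HN] := @centralized_engel (centralizer br K ss) A (maxn n p).
- exact: subalgebra_centralizer.
- by [].
- by move=> y /AH Hy; split=> [|s Hs]; [apply: HK|rewrite (brC Lbr) ssH ?oppr0].
- by move=> y /An; apply: gs_mono (leq_maxl _ _) _.
- move=> X s m AX J w [_ Hw]; rewrite (brC Lbr) Hw ?oppr0 //.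
  by exists X, m; split=> //; apply: AH.
exists N => ys sys Hys; apply: HN => //.
exact: gs_mono (leq_maxr _ _) _ px.
Qed.

End CartanSubalgebra.
End LocallyReductive.

Theorem theoremA2 (F : closedFieldType) (charF0 : [pchar F] =i pred0)
  (V : lmodType F) (br : V -> V -> V) (gs : nat -> V -> Prop)
  (K H : V -> Prop) :
  is_lie_bracket br -> locally_reductive br gs ->
  subalgebra br K -> splittable br gs K ->
  subalgebra br H -> psubset H K ->
  let P1 := pset_eq H (centralizer br K (ss_part br gs H)) in
  let P2 := exists T, max_toral br gs K T /\ pset_eq H (centralizer br K T) in
  let P3 := pset_eq H (k0bar br K H) in
  (P1 <-> P2) /\ (P1 <-> P3) /\
  (P1 -> [/\ loc_nilpotent br H, splittable br gs H & self_normalizing br K H]).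
Proof.
move=> Lbr LR SK splitK SH HK P1 P2 P3; split; [|split].
- split=> [HE|[T [maxT HT]]]; last exact: (centralizer_max_toral _ _ _ _ _ _ maxT).
  by exists (ss_part br gs H); split=> //; apply: ss_part_max_toral.
- by split; [apply: centralizer_k0bar|apply: k0bar_centralizer].
- move=> HE; split.
  + exact: (centralizer_loc_nilpotent charF0 Lbr LR SH HE).
  + exact: (centralizer_splittable charF0 Lbr LR splitK SH HK HE).
  + exact: (centralizer_self_normalizing charF0 Lbr LR splitK SH HK HE).
Qed.
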